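(* Let $g$ and $\bar g$ be geodesically equivalent nonproportional (Riemannian or pseudo-Riemannian) metrics on a manifold $M^n$. Then at every point the Riemann curvature tensor $R^{i,k}_{j,l}$ of $g$, regarded as a linear operator $R: so(g)\to so(g)$, is a sectional operator. More precisely, $R$ is symmetric with respect to the Killing form and $$[R(x),a]=[x,b]\qquad\text{for all } x\in so(g),$$ where $a$ is the $g$-symmetric operator $a^i_j=g^{ik}a_{kj}$ associated with the form $$a_{ij}=\left|\frac{\det(\bar g)}{\det(g)}\right|^{\frac1{n+1}} g_{i\alpha}\bar g^{\alpha\beta}g_{\beta j},$$ and $b$ is the $g$-symmetric operator $b^i_j=2g^{ik}\lambda_{,kj}$ associated with the form $2\lambda_{,ij}$, where $\lambda=\tfrac12 a_{\alpha\beta}g^{\alpha\beta}$ (so that $2\lambda_{,ij}$ is the Hessian of $\mathrm{tr}\,a$).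
   Context: Two (pseudo-)Riemannian metrics on the same manifold are geodesically equivalent if they have the same unparametrized geodesics. Commas denote covariant derivatives with respect to the Levi-Civita connection of $g$ (so $\lambda_{,ij}$ is the Hessian of $\lambda$). At a given point, $Sym(g)$ is the space of linear operators on the tangent space that are symmetric (self-adjoint) with respect to $g$, and $so(g)$ is the Lie algebra of $g$-skew-symmetric operators; $[\cdot,\cdot]$ is the commutator of operators. A linear operator $R:so(g)\to so(g)$ is called a sectional operator associated with $a,b\in Sym(g)$ if $R$ is symmetric with respect to the Killing form of $so(g)$ and $[R(x),a]=[x,b]$ for all $x\in so(g)$. Curvature convention: $R^\alpha_{\ jkl}$ is defined so that $w_{j,kl}-w_{j,lk}=w_\alpha R^\alpha_{\ jkl}$ for covectors $w$ (where $w_{j,kl}$ means that one differentiates first in direction $k$, then in direction $l$), so $a_{ij,kl}-a_{ij,lk}=a_{i\alpha}R^\alpha_{\ jkl}+a_{\alpha j}R^\alpha_{\ ikl}$ for $(0,2)$-tensors. Put $R_{ij,kl}=g_{i\alpha}R^\alpha_{\ jkl}$ and let $R^{i,k}_{j,l}$ be obtained from $R_{ij,kl}$ by raising the indices $i$ and $k$ with $g$. Due to its skew-symmetry in $i,j$ and in $k,l$ and its symmetry under exchange of the pairs $(ij)$, $(kl)$, the tensor is regarded as an operator on $so(g)$ by $R(x)^i_j=R^{i,k}_{j,l}\,x^l_k$. *)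

(* Defs.v *)
From HB Require Import structures.
From mathcomp Require Import all_boot all_order all_algebra.
From mathcomp Require Import all_classical all_reals all_analysis.
From mathcomp Require Import ring.

Set Implicit Arguments.
Unset Strict Implicit.
Unset Printing Implicit Defensive.

Import Order.TTheory GRing.Theory Num.Theory.
Import numFieldNormedType.Exports.

Local Open Scope classical_set_scope.
Local Open Scope ring_scope.

Section Calculus.
Variables (R : realType) (n : nat).
Implicit Types (U : set 'rV[R]_n) (f : 'rV[R]_n -> R).

Definition partial (i : 'I_n) f : 'rV[R]_n -> R :=
  fun x => 'D_(delta_mx 0 i) f x.

Fixpoint Ck (k : nat) U f : Prop :=
  (forall x, U x -> {for x, continuous f}) /\
  if k is k'.+1 then
    forall i, (forall x, U x -> derivable f x (delta_mx 0 i)) /\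
              Ck k' U (partial i f)
  else True.

Definition smooth_on U f : Prop := forall k, Ck k U f.

End Calculus.

(* Manifolds of dimension n, without boundary and not assumed connected. *)
Section Manifold.
Variables (R : realType) (n : nat).

Record chart (M : topologicalType) := Chart {
  cdom : set M;
  ccod : set 'rV[R]_n;
  cmap : M -> 'rV[R]_n;
  cinv : 'rV[R]_n -> M;
  cdom_open : open cdom;
  ccod_open : open ccod;
  cmap_cod : forall p, cdom p -> ccod (cmap p);
  cinv_dom : forall x, ccod x -> cdom (cinv x);
  cmapK : forall p, cdom p -> cinv (cmap p) = p;
  cinvK : forall x, ccod x -> cmap (cinv x) = x;
  cmap_continuous : forall p, cdom p -> {for p, continuous cmap};
  cinv_continuous : forall x, ccod x -> {for x, continuous cinv} }.

Definition transition (M : topologicalType) (c d : chart M) :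
    'rV[R]_n -> 'rV[R]_n :=
  fun x => cmap d (cinv c x).

Definition overlap (M : topologicalType) (c d : chart M) : set 'rV[R]_n :=
  [set x | ccod c x /\ cdom d (cinv c x)].

Record manifold := Manifold {
  carrier :> topologicalType;
  carrier_hausdorff : hausdorff_space carrier;
  carrier_second_countable : @second_countable carrier;
  chart_index : Type;
  atlas : chart_index -> chart carrier;
  atlas_cover : forall p, exists c, cdom (atlas c) p;
  atlas_smooth : forall (c d : chart_index) (i : 'I_n),
    smooth_on (overlap (atlas c) (atlas d))
      (fun x => transition (atlas c) (atlas d) x 0 i) }.

(* A metric of arbitrary signature, given by its matrices of components in the
   charts of the atlas; only the values on the codomain of a chart matter. *)
Record metric (M : manifold) := Metric {
  gcomp :> chart_index M -> 'rV[R]_n -> 'M[R]_n;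
  gcomp_smooth : forall c i j,
    smooth_on (ccod (atlas c)) (fun x => gcomp c x i j);
  gcomp_sym : forall c x, ccod (atlas c) x -> (gcomp c x)^T = gcomp c x;
  gcomp_nondegenerate : forall c x,
    ccod (atlas c) x -> gcomp c x \in unitmx;
  gcomp_transition : forall c d x, overlap (atlas c) (atlas d) x ->
    let tau := transition (atlas c) (atlas d) in
    forall i j, gcomp c x i j =
      \sum_k \sum_l partial i (fun y => tau y 0 k) x *
                    partial j (fun y => tau y 0 l) x *
                    gcomp d (tau x) k l }.

Definition proportional (M : manifold) (g h : metric M) : Prop :=
  exists k : R, forall c x, ccod (atlas c) x -> h c x = k *: g c x.

End Manifold.

(* Tensor calculus in a coordinate domain; G is the matrix field g_{ij}.
   A covector field w is the family of its components w_j. *)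
Section LocalTensors.
Variables (R : realType) (n : nat).
Implicit Types (G H : 'rV[R]_n -> 'M[R]_n) (x : 'rV[R]_n).

(* christoffel G i j k is Gamma^i_{jk}. *)
Definition christoffel G (i j k : 'I_n) x : R :=
  2^-1 * \sum_a invmx (G x) i a *
    (partial j (fun y => G y a k) x + partial k (fun y => G y a j) x
     - partial a (fun y => G y j k) x).

(* cov1 G w j k is w_{j,k}. *)
Definition cov1 G (w : 'I_n -> 'rV[R]_n -> R) (j k : 'I_n) x : R :=
  partial k (w j) x - \sum_a christoffel G a j k x * w a x.

(* cov2 G t j k l is t_{jk,l}; hence cov2 G (cov1 G w) j k l is w_{j,kl}. *)
Definition cov2 G (t : 'I_n -> 'I_n -> 'rV[R]_n -> R) (j k l : 'I_n) x : R :=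
  partial l (t j k) x - \sum_a christoffel G a j l x * t a k x
                      - \sum_a christoffel G a k l x * t j a x.

(* riemann G i j k l is R^i_{jkl}, normalised by
   w_{j,kl} - w_{j,lk} = w_i R^i_{jkl}; see ricci_identity below. *)
Definition riemann G (i j k l : 'I_n) x : R :=
  partial k (christoffel G i j l) x - partial l (christoffel G i j k) x
  + \sum_a christoffel G a j l x * christoffel G i a k x
  - \sum_a christoffel G a j k x * christoffel G i a l x.

(* R_{ij,kl} *)
Definition riemann_low G (i j k l : 'I_n) x : R :=
  \sum_a G x i a * riemann G a j k l x.

(* riemann_op_coef G i j k l is R^{i,k}_{j,l}. *)
Definition riemann_op_coef G (i j k l : 'I_n) x : R :=
  \sum_p \sum_q invmx (G x) i p * invmx (G x) k q * riemann_low G p j q l x.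

(* Operators on the tangent space are matrices with X^i_j = X i j. *)
Definition curvature_op G x (X : 'M[R]_n) : 'M[R]_n :=
  \matrix_(i, j) \sum_k \sum_l riemann_op_coef G i j k l x * X l k.

Definition a_form G H x : 'M[R]_n :=
  (`|\det (H x) / \det (G x)| `^ (n.+1%:R)^-1) *:
    (G x *m invmx (H x) *m G x).

Definition a_op G H x : 'M[R]_n := invmx (G x) *m a_form G H x.

Definition lam G H x : R :=
  2^-1 * \sum_i \sum_j a_form G H x i j * invmx (G x) i j.

Definition hessian G (f : 'rV[R]_n -> R) x : 'M[R]_n :=
  \matrix_(i, j) cov1 G (fun k => partial k f) i j x.

Definition b_op G H x : 'M[R]_n :=
  2 *: (invmx (G x) *m hessian G (lam G H) x).

End LocalTensors.

Section Schwarz.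
Variables (R : realType) (n : nat).
Implicit Types (f : 'rV[R]_n -> R) (u v x y : 'rV[R]_n).

Lemma is_derive_line f v y (s : R) : derivable f (s *: v + y) v ->
  is_derive s (1 : R) (fun t : R => f (t *: v + y)) ('D_v f (s *: v + y)).
Proof.
have E : (fun h : R => h^-1 *: (f ((h *: (1 : R) + s) *: v + y) - f (s *: v + y)))
       = (fun h : R => h^-1 *: (f (h *: v + (s *: v + y)) - f (s *: v + y))).
  by apply/funext => h; rewrite [h *: (1 : R)]mulr1 scalerDl addrA.
by move=> df; apply: DeriveDef; rewrite /derivable /derive /= E.
Qed.

Lemma MVT_line f v y (h : R) : 0 <= h ->
  (forall s, 0 <= s <= h -> derivable f (s *: v + y) v) ->
  exists2 s, 0 <= s <= h & f (h *: v + y) - f y = h * 'D_v f (s *: v + y).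
Proof.
move=> h0 df.
have [||s] := @MVT_segment R (fun t => f (t *: v + y))
  (fun t => 'D_v f (t *: v + y)) 0 h h0.
- move=> t; rewrite in_itv/= => /andP[t0 th].
  by apply: is_derive_line; apply: df; rewrite !ltW.
- apply: derivable_within_continuous => t; rewrite in_itv/= => tI.
  by have [] := is_derive_line (df _ tI).
- rewrite in_itv/= scale0r add0r subr0 mulrC => sI ->.
  by exists s.
Qed.

Lemma second_difference f u v x (h : R) : 0 <= h ->
  (forall s t, 0 <= s <= h -> 0 <= t <= h ->
    derivable f (s *: u + (t *: v + x)) u /\
    derivable ('D_u f) (s *: u + (t *: v + x)) v) ->
  exists s t, [/\ 0 <= s <= h, 0 <= t <= h &
    f (h *: u + (h *: v + x)) - f (h *: u + x) - f (h *: v + x) + f x =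
    h ^+ 2 * 'D_v ('D_u f) (s *: u + (t *: v + x))].
Proof.
move=> h0 df.
have hI : 0 <= h <= h by rewrite h0 lexx.
have zI : 0 <= (0 : R) <= h by rewrite h0 lexx.
pose F y := f (h *: v + y) - f y.
have dF s : 0 <= s <= h -> is_derive (s *: u + x) u F
    ('D_u f (h *: v + (s *: u + x)) - 'D_u f (s *: u + x)).
  move=> sI.
  have [d1 _] := df s h sI hI; have [d2 _] := df s 0 sI zI.
  rewrite scale0r add0r in d2.
  have d3 : is_derive (s *: u + x) u (fun y => f (h *: v + y))
      ('D_u f (h *: v + (s *: u + x))).
    have E : (fun k : R => k^-1 *: (f (h *: v + (k *: u + (s *: u + x))) - f (h *: v + (s *: u + x)))) =
      (fun k : R => k^-1 *: (f (k *: u + (h *: v + (s *: u + x))) - f (h *: v + (s *: u + x)))).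
      by apply/funext => k; rewrite addrCA.
    rewrite addrCA in d1.
    by apply: DeriveDef; rewrite /derivable /derive /= E.
  by have d4 := derivableP d2; apply: is_deriveB.
have [s sI Es] := @MVT_line F u x h h0 (fun s sI => @ex_derive _ _ _ _ _ _ _ (dF s sI)).
have [t tI Et] := @MVT_line ('D_u f) v (s *: u + x) h h0
   (fun t tI => ltac:(by have [_] := df s t sI tI; rewrite addrCA)).
exists s, t; split; [exact: sI | exact: tI |].
move: Es; rewrite (@derive_val _ _ _ _ _ _ _ (dF s sI)) Et /F => Es.
rewrite [s *: u + _]addrCA expr2 -mulrA -Es [h *: v + (h *: u + x)]addrCA.
by rewrite opprB -!addrA [- f (h *: v + x) + _]addrC.
Qed.

Lemma schwarz (U : set 'rV[R]_n) f i j x : open U -> U x -> Ck 2 U f ->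
  partial i (partial j f) x = partial j (partial i f) x.
Proof.
move=> Uo Ux [_ C1].
pose e (k : 'I_n) : 'rV[R]_n := delta_mx 0 k.
have P k l : {for x, continuous (partial l (partial k f))} /\
  forall y, U y -> derivable f y (e k) /\ derivable (partial k f) y (e l).
  have [dk [_ Ckk]] := C1 k; have [dl [cl _]] := Ckk l.
  by split=> [|y Uy]; [exact: cl|split; [exact: dk|exact: dl]].
have ctr (k l : 'I_n) (eps : R) : 0 < eps -> exists2 d : R, 0 < d &
    forall y, `|y| < d -> U (y + x) /\
      `|partial l (partial k f) x - partial l (partial k f) (y + x)| < eps.
  move=> eps0; have [c _] := P k l.
  have : \forall y \near x, U y /\
      `|partial l (partial k f) x - partial l (partial k f) y| < eps.
    near=> y; split; first by near: y; exact: open_nbhs_nbhs.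
    by near: y; have /cvgrPdist_lt := c; exact.
  move=> /nbhs_ballP[d /= d0 dP]; exists d => // y yd.
  by apply: dP; rewrite -ball_normE/= opprD addrCA subrr addr0 normrN.
apply/eqP; rewrite -subr_eq0 -normr_le0; apply/ler_addgt0Pl => eps eps0; rewrite addr0.
have e2 : 0 < eps / 2 by rewrite divr_gt0.
have [d1 d10 D1] := ctr i j _ e2.
have [d2 d20 D2] := ctr j i _ e2.
pose d := Num.min d1 d2.
have d0 : 0 < d by rewrite lt_min d10.
pose N := 1 + `|e i| + `|e j|.
have N0 : 0 < N by rewrite /N -addrA ltr_pwDl// addr_ge0.
pose h := d / N.
have h0 : 0 < h by rewrite divr_gt0.
have small s t : 0 <= s <= h -> 0 <= t <= h -> `|s *: e i + t *: e j| < d.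
  move=> /andP[s0 sh] /andP[t0 th].
  have -> : d = h * N by rewrite divfK// gt_eqF.
  rewrite (le_lt_trans (ler_normD _ _))// !normrZ !ger0_norm//.
  rewrite /N !mulrDr mulr1 -addrA ltr_pwDl// lerD// ler_wpM2r//.
have small' s t : 0 <= s <= h -> 0 <= t <= h -> `|s *: e j + t *: e i| < d.
  by move=> sI tI; rewrite addrC; exact: small.
have dd1 y : `|y| < d -> `|y| < d1 by move/lt_le_trans; apply; rewrite ge_min lexx.
have dd2 y : `|y| < d -> `|y| < d2 by move/lt_le_trans; apply; rewrite ge_min lexx orbT.
have [|s [t [sI tI E1]]] := @second_difference f (e j) (e i) x h (ltW h0).
  move=> s t sI tI; have [_ /(_ (s *: e j + (t *: e i + x)))] := P j i.
  by apply; rewrite addrA; have [] := D2 _ (dd2 _ (small' _ _ sI tI)).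
have [|s' [t' [sI' tI' E2]]] := @second_difference f (e i) (e j) x h (ltW h0).
  move=> s' t' sI' tI'; have [_ /(_ (s' *: e i + (t' *: e j + x)))] := P i j.
  by apply; rewrite addrA; have [] := D2 _ (dd2 _ (small _ _ sI' tI')).
have E : 'D_(e i) ('D_(e j) f) (s *: e j + (t *: e i + x)) =
         'D_(e j) ('D_(e i) f) (s' *: e i + (t' *: e j + x)).
  apply: (@mulfI _ (h ^+ 2)); first by rewrite expf_neq0// gt_eqF.
  apply: etrans (etrans (esym E1) _) E2.
  rewrite [h *: e i + (h *: e j + x)]addrCA.
  by congr (_ + _); rewrite addrAC.
rewrite !addrA in E.
have [_ B1] := D2 _ (dd2 _ (small' _ _ sI tI)).
have [_ B2] := D1 _ (dd1 _ (small _ _ sI' tI')).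
change (partial i (partial j f) (s *: e j + t *: e i + x) =
  partial j (partial i f) (s' *: e i + t' *: e j + x)) in E.
set a := partial i (partial j f) x in B1 *; set b := partial j (partial i f) x in B2 *.
set a' := partial i (partial j f) _ in B1 E; set b' := partial j (partial i f) _ in B2 E.
have -> : a - b = (a - a') - (b - b') by rewrite E opprB addrA subrK.
apply: le_trans (ler_normB _ _) _; rewrite [eps]splitr.
exact: lerD (ltW B1) (ltW B2).
Unshelve. all: by end_near.
Qed.
End Schwarz.

Lemma ricci_algebra (A : comNzRingType) (n : nat) (j k l : 'I_n) (c : A)
    (wk wl w : 'I_n -> A) (C : 'I_n -> 'I_n -> 'I_n -> A)
    (Dk Dl t : 'I_n -> A) :
  (forall a, C a k l = C a l k) ->
  c - \sum_a (Dl a * w a + C a j k * wl a)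
    - \sum_a C a j l * (wk a - \sum_b C b a k * w b)
    - \sum_a C a k l * t a
  - (c - \sum_a (Dk a * w a + C a j l * wk a)
       - \sum_a C a j k * (wl a - \sum_b C b a l * w b)
       - \sum_a C a l k * t a)
  = \sum_a w a * (Dk a - Dl a + \sum_b C b j l * C a b k
                               - \sum_b C b j k * C a b l).
Proof.
move=> Ckl.
have -> : \sum_a C a k l * t a = \sum_a C a l k * t a.
  by apply: eq_bigr => a _; rewrite Ckl.
have X m p (wp : 'I_n -> A) : \sum_a C a j m * (wp a - \sum_b C b a p * w b) =
   \sum_a C a j m * wp a - \sum_a w a * \sum_b C b j m * C a b p.
  under eq_bigr do rewrite mulrBr mulr_sumr.
  rewrite sumrB; congr (_ - _); rewrite exchange_big/=; apply: eq_bigr => a _.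
  by rewrite mulr_sumr; apply: eq_bigr => b _; ring.
rewrite !X !big_split/=.
under [RHS]eq_bigr do rewrite mulrBr mulrDr mulrBr.
rewrite !sumrB big_split/= sumrB.
under [\sum_a w a * Dk a]eq_bigr do rewrite mulrC.
under [\sum_a w a * Dl a]eq_bigr do rewrite mulrC.
ring.
Qed.

Section Ricci.
Variables (R : realType) (n : nat).

Lemma christoffelC (U : set 'rV[R]_n) (G : 'rV[R]_n -> 'M[R]_n) i j k x :
  open U -> U x -> (forall y, U y -> (G y)^T = G y) ->
  christoffel G i j k x = christoffel G i k j x.
Proof.
move=> Uo Ux Gs; rewrite /christoffel; congr (_ * _); apply: eq_bigr => a _.
congr (_ * (_ - _)); first exact: addrC.
rewrite /partial; apply: near_eq_derive.
apply: filterS (open_nbhs_nbhs (conj Uo Ux)) => y Uy.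
by rewrite -[in LHS](Gs y Uy) mxE.
Qed.

(* The Christoffel symbols of a smooth metric are smooth, so the hypothesis on
   their derivability holds in every chart. *)
Lemma ricci_identity (U : set 'rV[R]_n) (G : 'rV[R]_n -> 'M[R]_n)
    (w : 'I_n -> 'rV[R]_n -> R) (j k l : 'I_n) x :
  open U -> U x -> (forall y, U y -> (G y)^T = G y) ->
  (forall a b c d, derivable (christoffel G a b c) x (delta_mx 0 d)) ->
  (forall a, Ck 2 U (w a)) ->
  cov2 G (cov1 G w) j k l x - cov2 G (cov1 G w) j l k x =
  \sum_a w a x * riemann G a j k l x.
Proof.
move=> Uo Ux Gs dG Cw.
have dw a b : derivable (w a) x (delta_mx 0 b).
  by have [_ /(_ b)[d _]] := Cw a; exact: d.
have dpw a b c : derivable (partial b (w a)) x (delta_mx 0 c).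
  by have [_ /(_ b)[_ [_ /(_ c)[d _]]]] := Cw a; exact: d.
have D k' l' : partial l' (cov1 G w j k') x =
   partial l' (partial k' (w j)) x -
   \sum_a (partial l' (christoffel G a j k') x * w a x
     + christoffel G a j k' x * partial l' (w a) x).
  rewrite /partial /cov1.
  have dS a : is_derive x (delta_mx 0 l') (fun y => christoffel G a j k' y * w a y)
      (christoffel G a j k' x * 'D_(delta_mx 0 l') (w a) x
       + w a x * 'D_(delta_mx 0 l') (christoffel G a j k') x).
    by apply: is_deriveM; exact: derivableP.
  have dSS : is_derive x (delta_mx 0 l') (fun y => \sum_a christoffel G a j k' y * w a y)
     (\sum_a (christoffel G a j k' x * 'D_(delta_mx 0 l') (w a) x
       + w a x * 'D_(delta_mx 0 l') (christoffel G a j k') x)).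
    rewrite -(_ : \sum_a (fun y => christoffel G a j k' y * w a y) = (fun y => \sum_a christoffel G a j k' y * w a y)); last first.
      by apply/funext => y; rewrite fct_sumE.
    exact: is_derive_sum.
  have dpP := derivableP (dpw j k' l').
  have dT := @is_deriveB _ _ _ _ _ _ _ _ _ dpP dSS.
  rewrite (@derive_val _ _ _ _ _ _ _ dT); congr (_ - _); apply: eq_bigr => a _.
  by rewrite addrC mulrC.
rewrite /cov2 !D (schwarz l k Uo Ux (Cw j)) /cov1 /riemann.
have := @ricci_algebra R n j k l (partial k (partial l (w j)) x)
  (fun a => partial k (w a) x) (fun a => partial l (w a) x) (fun a => w a x)
  (fun a b c => christoffel G a b c x)
  (fun a => partial k (christoffel G a j l) x)
  (fun a => partial l (christoffel G a j k) x)
  (fun a => partial a (w j) x - \sum_b christoffel G b j a x * w b x)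
  (fun a => christoffelC a k l Uo Ux Gs).
exact.
Qed.
End Ricci.

Section SectionalOperators.
Variables (R : realType) (n : nat).
Implicit Types (g X Y A B : 'M[R]_n).

Definition lie X Y : 'M[R]_n := X *m Y - Y *m X.

Definition Sym g A : Prop := A^T *m g = g *m A.

Definition so_defect g X : 'M[R]_n := X^T *m g + g *m X.

Fact so_defect_is_linear g : linear (so_defect g).
Proof.
move=> k X Y; rewrite /so_defect linearD linearZ/= mulmxDl mulmxDr.
by rewrite -scalemxAl -scalemxAr scalerDr addrACA.
Qed.

HB.instance Definition _ g :=
  GRing.isLinear.Build R 'M[R]_n 'M[R]_n *:%R (so_defect g)
    (so_defect_is_linear g).

Definition so g : {vspace 'M[R]_n} := lker (linfun (so_defect g)).

Lemma soP g X : (X \in so g) <-> X^T *m g = - (g *m X).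
Proof.
rewrite memv_ker lfunE/= /so_defect addr_eq0.
by split => [/eqP|->].
Qed.

(* The trace of ad X \o ad Y on the matrix Lie algebra L. *)
Definition killing (L : {vspace 'M[R]_n}) X Y : R :=
  \sum_(i < \dim L) coord (vbasis L) i (lie X (lie Y (vbasis L)`_i)).

Definition sectional_operator g (S : 'M[R]_n -> 'M[R]_n) A B : Prop :=
  [/\ Sym g A /\ Sym g B,
      forall X, X \in so g -> S X \in so g,
      forall k X Y, X \in so g -> Y \in so g -> S (k *: X + Y) = k *: S X + S Y,
      forall X Y, X \in so g -> Y \in so g ->
        killing (so g) (S X) Y = killing (so g) X (S Y)
    & forall X, X \in so g -> lie (S X) A = lie X B].

End SectionalOperators.

Section Geodesics.
Variables (R : realType) (n : nat) (M : manifold R n).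
Implicit Types (g h : metric M) (I J : set R) (gam : R -> M).

Definition open_interval I : Prop := open I /\ is_interval I.

(* Affinely parametrised geodesics; only the restriction of gam to I matters.
   Smoothness of gam on I follows from the equation. *)
Definition geodesic g I gam : Prop :=
  forall t, I t -> {for t, continuous gam} /\
    forall c, cdom (atlas c) (gam t) ->
      let x (i : 'I_n) (s : R) : R := cmap (atlas c) (gam s) 0 i in
      forall i,
        [/\ derivable (x i) t 1,
            derivable (derive1 (x i)) t 1
          & derive1n 2 (x i) t +
            \sum_j \sum_k christoffel (g c) i j k (cmap (atlas c) (gam t)) *
                          derive1 (x j) t * derive1 (x k) t = 0].

Definition unparametrized_geodesic g I gam : Prop :=
  exists (J : set R) (phi : R -> R),
    [/\ open_interval J,
        forall k t, J t -> derivable (derive1n k phi) t 1,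
        forall t, J t -> derive1 phi t != 0,
        phi @` J = I
      & geodesic g J (gam \o phi)].

Definition geodesically_equivalent g h : Prop :=
  forall I gam, open_interval I ->
    unparametrized_geodesic g I gam <-> unparametrized_geodesic h I gam.

End Geodesics.

(* Main.v *)
(* A geodesic of g issuing from any point in any direction exists (Picard), and
   in every chart it solves the Euler-Lagrange equation of the energy.  It is also
   an unparametrised geodesic of gbar, so the difference T of the two Levi-Civita
   connections satisfies T(v,v) ^ v = 0; polarising,
   T^i_jk = delta^i_j phi_k + delta^i_k phi_j, and phi is half the differential of
   ln |det gbar / det g|^(1/(n+1)).  Hence the form a satisfies the linear equation
   a_ij,k = lambda_i g_jk + lambda_j g_ik with lambda_i = lambda_,i.  Its
   integrability condition is the Ricci identity
   a_ia R^a_jkl + a_aj R^a_ikl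
     = lambda_,il g_jk + lambda_,jl g_ik - lambda_,ik g_jl - lambda_,jk g_il,
   whose contraction with the bivector of x is [R(x),a] = [x,b].  Symmetry of R for
   the Killing form is the pair symmetry of the curvature, as the Killing form of
   so(g) is (n-2) tr(xy). *)
Require Import Defs.
From HB Require Import structures.
From mathcomp Require Import all_boot all_order all_algebra.
From mathcomp Require Import all_classical all_reals all_analysis.
From mathcomp Require Import perm ring lra.

Set Implicit Arguments.
Unset Strict Implicit.
Unset Printing Implicit Defensive.

Import Order.TTheory GRing.Theory Num.Theory.
Import numFieldNormedType.Exports.

Local Open Scope classical_set_scope.
Local Open Scope ring_scope.

(** * Derivatives and functions of class C^k *)

(** [geodesic] demands the equation in every chart of the atlas, while Picard's theorem solves it in
    one. The Euler-Lagrange form bridges the gap: the derivative of the momentum [G v] and half the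
    gradient of g(v,v) both change by the Jacobian plus one and the same term in second derivatives,
    so the difference is a covector and the transformation law of the Christoffel symbols never has
    to be written.

    The exponent 1/(n+1) is dictated by a cancellation. In the derivative of g gbar^-1 g, the part
    delta^i_j phi_k of T costs -2 phi_k times the form; the power of the determinant ratio
    contributes +2 phi_k. What survives has the shape u_i g_jk + u_j g_ik, and tracing it with g
    identifies u with the differential of lambda.

    Index calculus is replaced by matrices: for fixed directions, the connection and the curvature
    are endomorphisms, and vectors x of so(g) act through the skew matrix x g^-1. A single
    integrability lemma then serves twice: for g with zero covector it gives the skew-symmetry of
    the curvature, for a with the differential of lambda it gives the commutator identity. *)

Section Derivatives.
Variables (R : realType) (V : normedModType R).
Implicit Types (f g : V -> R) (x v : V).

Lemma is_derive_prod f g x v (a b : R) :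
  is_derive x v f a -> is_derive x v g b ->
  is_derive x v (fun y => f y * g y) (a * g x + f x * b).
Proof.
move=> df dg; have -> : a * g x + f x * b = f x *: b + g x *: a.
  by rewrite addrC [g x *: a]mulrC.
exact: is_deriveM.
Qed.

Lemma is_derive_add f g x v (a b : R) :
  is_derive x v f a -> is_derive x v g b ->
  is_derive x v (fun y => f y + g y) (a + b).
Proof. by move=> df dg; exact: (is_deriveD df dg). Qed.

Lemma is_derive_const (a : R) x v : is_derive x v (fun=> a) 0.
Proof. exact: is_derive_cst. Qed.

Lemma is_derive_sub f g x v (a b : R) :
  is_derive x v f a -> is_derive x v g b ->
  is_derive x v (fun y => f y - g y) (a - b).
Proof. by move=> df dg; exact: (is_deriveB df dg). Qed.

Lemma is_derive_bigsum (I : Type) (r : seq I) (P : pred I) (f : I -> V -> R)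
    (a : I -> R) x v :
  (forall i, is_derive x v (f i) (a i)) ->
  is_derive x v (fun y => \sum_(i <- r | P i) f i y) (\sum_(i <- r | P i) a i).
Proof.
move=> df; elim: r => [|i r IH].
  have -> : (fun y => \sum_(i <- [::] | P i) f i y) = cst 0.
    by apply/funext => y; rewrite big_nil.
  by rewrite big_nil; exact: is_derive_cst.
rewrite big_cons.
have -> : (fun y => \sum_(i <- i :: r | P i) f i y) =
  (fun y => if P i then f i y + \sum_(i <- r | P i) f i y
            else \sum_(i <- r | P i) f i y).
  by apply/funext => y; rewrite big_cons.
by case: (P i) => //; exact: is_derive_add.
Qed.

Lemma is_derive_inv f x v (a : R) : f x != 0 -> is_derive x v f a ->
  is_derive x v (fun y => (f y)^-1) (- (f x) ^- 2 * a).
Proof.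
move=> fx0 [df <-]; apply: DeriveDef; first exact: derivableV.
by rewrite deriveV.
Qed.

(** Both difference quotients are the same function of the increment. This carries one-variable
    results, such as composition, over to directional derivatives. *)
Lemma is_derive_along f x v (a : R) :
  is_derive (0 : R) (1 : R) (fun t : R => f (t *: v + x)) a <->
  is_derive x v f a.
Proof.
have E : (fun h : R => h^-1 *: (((fun t : R => f (t *: v + x)) \o shift 0) (h *: 1)
           - f (0 *: v + x))) =
         (fun h : R => h^-1 *: ((f \o shift x) (h *: v) - f x)).
  by apply/funext => h; rewrite /= addr0 scale0r add0r [h *: 1]mulr1.
by split=> -[d1 d2]; apply: DeriveDef; move: d1 d2; rewrite /derivable /derive /= E.
Qed.

Lemma is_derive_outer (phi : R -> R) f x v (a b : R) :
  is_derive (f x) (1 : R) phi b -> is_derive x v f a ->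
  is_derive x v (fun y => phi (f y)) (b * a).
Proof.
move=> dphi /is_derive_along df; apply/is_derive_along.
apply: (@is_derive1_comp _ phi (fun t : R => f (t *: v + x)) 0 b a) => //.
by rewrite scale0r add0r.
Qed.

Lemma is_derive_near f g x v (a : R) : (\near x, f x = g x) ->
  is_derive x v f a -> is_derive x v g a.
Proof. exact: near_eq_is_derive. Qed.

End Derivatives.

Section CkClosure.
Variables (R : realType) (n : nat) (U : set 'rV[R]_n).
Hypothesis Uo : open U.
Implicit Types (f g : 'rV[R]_n -> R).

Lemma partialP f i x : derivable f x (delta_mx 0 i) ->
  is_derive x (delta_mx 0 i) f (partial i f x).
Proof. exact: derivableP. Qed.

Lemma is_derive_partial f i x a : is_derive x (delta_mx 0 i) f a ->
  partial i f x = a.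
Proof. by move=> df; exact: derive_val. Qed.

Lemma partial_eq f g i x : U x -> (forall y, U y -> f y = g y) ->
  partial i f x = partial i g x.
Proof.
move=> Ux fg; rewrite /partial; apply: near_eq_derive.
by apply: filterS (open_nbhs_nbhs (conj Uo Ux)) => y /fg. Qed.

Lemma Ck_eq k f g : (forall y, U y -> f y = g y) -> Ck k U f -> Ck k U g.
Proof.
have ceq f' g' : (forall y, U y -> f' y = g' y) ->
    (forall x, U x -> {for x, continuous f'}) ->
    forall x, U x -> {for x, continuous g'}.
  move=> fg cf x Ux; have fgx : \forall y \near x, f' y = g' y.
    by near=> y; apply: fg; near: y; exact: open_nbhs_nbhs.
  rewrite /prop_for /continuous_at -(fg _ Ux).
  exact: (cvg_trans (near_eq_cvg fgx) (cf x Ux)).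
elim: k f g => [|k IH] f g fg /= [cf df]; split => //; try exact: ceq cf.
move=> i; have [dfi Cf] := df i; split.
  move=> x Ux; have fgx : \forall y \near x, f y = g y.
    by near=> y; apply: fg; near: y; exact: open_nbhs_nbhs.
  exact: (near_eq_derivable fgx (dfi x Ux)).
by apply: IH Cf => y Uy; exact: partial_eq.
Unshelve. all: by end_near. Qed.

Lemma CkS k f : Ck k.+1 U f -> Ck k U f.
Proof.
elim: k f => [|k IH] f /= [cf df]; split => //.
by move=> i; have [dfi Cf] := df i; split => //; exact: IH.
Qed.

Lemma Ck_continuous k f x : Ck k U f -> U x -> {for x, continuous f}.
Proof. by case: k => [|k] [cf _]; exact: cf. Qed.

Lemma Ck_derivable k f i x : Ck k.+1 U f -> U x ->
  is_derive x (delta_mx 0 i) f (partial i f x).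
Proof. by move=> [_ /(_ i)[df _]] Ux; apply: partialP; exact: df. Qed.

Lemma Ck_partial k f i : Ck k.+1 U f -> Ck k U (partial i f).
Proof. by move=> [_ /(_ i)[]]. Qed.

(** The form in which every closure property below is proved: candidates for the partial derivatives
    are exhibited, and the induction hypothesis is applied to them. *)
Lemma Ck_step k f (df : 'I_n -> 'rV[R]_n -> R) :
  (forall x, U x -> {for x, continuous f}) ->
  (forall i x, U x -> is_derive x (delta_mx 0 i) f (df i x)) ->
  (forall i, Ck k U (df i)) -> Ck k.+1 U f.
Proof.
move=> cf dfP Cdf; split => // i; split.
  by move=> x Ux; have [] := dfP i x Ux.
apply: Ck_eq (Cdf i) => y Uy.
by rewrite (is_derive_partial (dfP i y Uy)).
Qed.

Lemma Ck_cst k (a : R) : Ck k U (fun=> a).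
Proof.
elim: k a => [|k IH] a; first by split => // x _; exact: cst_continuous.
by apply: (@Ck_step _ _ (fun _ _ => 0)) => // x _; exact: cst_continuous.
Qed.

Lemma CkD k f g : Ck k U f -> Ck k U g -> Ck k U (fun x => f x + g x).
Proof.
elim: k f g => [|k IH] f g Cf Cg.
  by split=> // x Ux; apply: continuousD; [exact: (Ck_continuous Cf)|exact: (Ck_continuous Cg)].
apply: (@Ck_step _ _ (fun i x => partial i f x + partial i g x)).
- by move=> x Ux; apply: continuousD; [exact: (Ck_continuous Cf)|exact: (Ck_continuous Cg)].
- by move=> i x Ux; apply: is_derive_add; [exact: (Ck_derivable i Cf)|exact: (Ck_derivable i Cg)].
- by move=> i; apply: IH; exact: Ck_partial.
Qed.

Lemma CkM k f g : Ck k U f -> Ck k U g -> Ck k U (fun x => f x * g x).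
Proof.
elim: k f g => [|k IH] f g Cf Cg.
  by split=> // x Ux; apply: continuousM; [exact: (Ck_continuous Cf)|exact: (Ck_continuous Cg)].
apply: (@Ck_step _ _ (fun i x => partial i f x * g x + f x * partial i g x)).
- by move=> x Ux; apply: continuousM; [exact: (Ck_continuous Cf)|exact: (Ck_continuous Cg)].
- by move=> i x Ux; apply: is_derive_prod; [exact: (Ck_derivable i Cf)|exact: (Ck_derivable i Cg)].
- by move=> i; apply: CkD; apply: IH => //; (exact: Ck_partial || exact: CkS).
Qed.

Lemma CkZ k (a : R) f : Ck k U f -> Ck k U (fun x => a * f x).
Proof. by move=> Cf; apply: CkM => //; exact: Ck_cst. Qed.

Lemma CkN k f : Ck k U f -> Ck k U (fun x => - f x).
Proof. by move/(CkZ (-1)); apply: Ck_eq => y _; rewrite mulN1r. Qed.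

Lemma CkB k f g : Ck k U f -> Ck k U g -> Ck k U (fun x => f x - g x).
Proof. by move=> Cf Cg; apply: CkD => //; exact: CkN. Qed.

Lemma Ck_sum k (I : Type) (r : seq I) (P : pred I) (f : I -> 'rV[R]_n -> R) :
  (forall i, Ck k U (f i)) -> Ck k U (fun x => \sum_(i <- r | P i) f i x).
Proof.
move=> Cf; elim: r => [|i r IH].
  by apply: Ck_eq (Ck_cst k 0) => y _; rewrite big_nil.
case Pi: (P i); last by apply: Ck_eq IH => y _; rewrite big_cons Pi.
by apply: Ck_eq (CkD (Cf i) IH) => y _; rewrite big_cons Pi.
Qed.

Lemma Ck_prod k (I : Type) (r : seq I) (P : pred I) (f : I -> 'rV[R]_n -> R) :
  (forall i, Ck k U (f i)) -> Ck k U (fun x => \prod_(i <- r | P i) f i x).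
Proof.
move=> Cf; elim: r => [|i r IH].
  by apply: Ck_eq (Ck_cst k 1) => y _; rewrite big_nil.
case Pi: (P i); last by apply: Ck_eq IH => y _; rewrite big_cons Pi.
by apply: Ck_eq (CkM (Cf i) IH) => y _; rewrite big_cons Pi.
Qed.

Lemma CkV k f : (forall x, U x -> f x != 0) -> Ck k U f ->
  Ck k U (fun x => (f x)^-1).
Proof.
move=> f0; elim: k => [|k IH] Cf.
  by split=> // x Ux; apply: continuousV; [exact: f0|exact: (Ck_continuous Cf)].
apply: (@Ck_step _ _ (fun i x => - (f x) ^- 2 * partial i f x)).
- by move=> x Ux; apply: continuousV; [exact: f0|exact: (Ck_continuous Cf)].
- by move=> i x Ux; apply: is_derive_inv; [exact: f0|exact: (Ck_derivable i Cf)].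
- move=> i; apply: CkM; last exact: Ck_partial.
  (* The derivative of 1/f is a polynomial in 1/f and the derivative of f, so the induction on the
     order closes with [f] fixed. *)
  apply: CkN; have Cfk := IH (CkS Cf).
  by apply: Ck_eq (CkM Cfk Cfk) => y Uy; rewrite expr2 invfM.
Qed.

Lemma Ck_powR k f (r : R) : (forall x, U x -> 0 < f x) -> Ck k U f ->
  Ck k U (fun x => f x `^ r).
Proof.
(* The exponent is generalised because differentiation replaces [r] by [r - 1]. *)
move=> f0; elim: k r => [|k IH] r Cf.
  split=> // x Ux; apply: (@continuous_comp _ _ _ f (fun y => y `^ r)).
    exact: (Ck_continuous Cf).
  apply: differentiable_continuous; apply/derivable1_diffP.
  by have [] := is_derive1_powR r (f0 x Ux).
apply: (@Ck_step _ _ (fun i x => r * f x `^ (r - 1) * partial i f x)).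
- move=> x Ux; apply: (@continuous_comp _ _ _ f (fun y => y `^ r)).
    exact: (Ck_continuous Cf).
  apply: differentiable_continuous; apply/derivable1_diffP.
  by have [] := is_derive1_powR r (f0 x Ux).
- move=> i x Ux.
  exact: (is_derive_outer (is_derive1_powR r (f0 x Ux)) (Ck_derivable i Cf Ux)).
- move=> i; apply: CkM; last exact: Ck_partial.
  by apply: CkZ; apply: IH; exact: CkS.
Qed.

Lemma Ck_det k m (F : 'rV[R]_n -> 'M[R]_m) :
  (forall i j, Ck k U (fun x => F x i j)) -> Ck k U (fun x => \det (F x)).
Proof.
move=> CF; apply: Ck_sum => s; apply: CkZ.
by apply: Ck_prod => i; exact: CF.
Qed.

Lemma Ck_invmx k m (F : 'rV[R]_n -> 'M[R]_m) :
  (forall x, U x -> F x \in unitmx) ->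
  (forall i j, Ck k U (fun x => F x i j)) ->
  forall i j, Ck k U (fun x => invmx (F x) i j).
Proof.
move=> uF CF i j.
(* Cramer's rule: on [U] the entries of the inverse are quotients of determinants. *)
apply: (@Ck_eq _ (fun x => (\det (F x))^-1 * cofactor (F x) j i)).
  by move=> y Uy; rewrite /invmx uF// !mxE.
apply: CkM; first by apply: CkV; [move=> x /uF; rewrite unitmxE unitfE|exact: Ck_det].
apply: CkZ; apply: Ck_det => a b.
by apply: Ck_eq (CF (lift j a) (lift i b)) => y _; rewrite !mxE.
Qed.

End CkClosure.

(** * The chain rule *)

Section ChainRule.
Variables (R : realType) (n : nat) (U : set 'rV[R]_n).
Hypothesis Uo : open U.
Implicit Types (f : 'rV[R]_n -> R) (x y z : 'rV[R]_n).

Lemma partial_close f x (e : R) : Ck 1 U f -> U x -> 0 < e ->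
  exists2 d : R, 0 < d & forall y, (forall i, `|y 0 i - x 0 i| < d) ->
    U y /\ forall k, `|partial k f y - partial k f x| <= e.
Proof.
move=> Cf Ux e0.
have : \forall y \near x, U y /\ forall k, `|partial k f y - partial k f x| <= e.
  near=> y; split; first by near: y; exact: open_nbhs_nbhs.
  near: y; apply: filter_forall => k.
  have /cvgrPdist_le/(_ e e0) := Ck_continuous (Ck_partial k Cf) Ux.
  by apply: filterS => y; rewrite distrC.
move=> /nbhs_ballP[d /= d0 dP]; exists d => // y yd; apply: dP.
split=> // i j; rewrite ord1 /ball/= distrC; exact: yd.
Unshelve. all: by end_near. Qed.

Lemma partial_increment f k x (d e a s : R) :
  (forall y, (forall i, `|y 0 i - x 0 i| < d) ->
    derivable f y (delta_mx 0 k) /\ `|partial k f y - a| <= e) ->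
  forall y, (forall i, `|y 0 i - x 0 i| < d) ->
    (forall i, `|(s *: delta_mx 0 k + y) 0 i - x 0 i| < d) ->
  `|f (s *: delta_mx 0 k + y) - f y - a * s| <= e * `|s|.
Proof.
move=> fP.
have pos t y : 0 <= t -> (forall i, `|y 0 i - x 0 i| < d) ->
    (forall i, `|(t *: delta_mx 0 k + y) 0 i - x 0 i| < d) ->
    `|f (t *: delta_mx 0 k + y) - f y - a * t| <= e * `|t|.
  move=> t0 yd tyd.
  have seg u : 0 <= u <= t -> forall i, `|(u *: delta_mx 0 k + y) 0 i - x 0 i| < d.
    move=> /andP[u0 ut] i; have := yd i; have := tyd i; rewrite !mxE eqxx/=.
    case: (i == k); rewrite ?mulr0 ?add0r// !mulr1 !ltr_norml => /andP[? ?] /andP[? ?].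
    by apply/andP; split; lra.
  have [|u ut ->] := @MVT_line R n f (delta_mx 0 k) y t t0.
    by move=> u ut; have [] := fP _ (seg u ut).
  have [_ H] := fP _ (seg u ut).
  rewrite [t * _]mulrC -mulrBl normrM ler_wpM2r//.
(* The mean value theorem was applied to nonnegative increments; a negative one is read backwards
   from the other endpoint. *)
move=> y yd syd; have [s0|s0] := leP 0 s; first exact: pos.
have E : - s *: delta_mx 0 k + (s *: delta_mx 0 k + y) = y.
  by rewrite scaleNr addKr.
have := pos (- s) (s *: delta_mx 0 k + y); rewrite E normrN => H.
have -> : f (s *: delta_mx 0 k + y) - f y - a * s =
   - (f y - f (s *: delta_mx 0 k + y) - a * - s) by ring.
by rewrite normrN; apply: H => //; rewrite oppr_ge0 ltW.
Qed.

(** Strict differentiability of C^1 functions: the path from [z] to [y] changes one coordinate at a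
    time, and each leg is estimated by the mean value theorem. With [z] at the centre it gives the
    chain rule, with both points free the local Lipschitz bound. *)
Lemma strict_derivative f x (e : R) : Ck 1 U f -> U x -> 0 < e ->
  exists2 d : R, 0 < d & forall y z, (forall i, `|y 0 i - x 0 i| < d) ->
    (forall i, `|z 0 i - x 0 i| < d) ->
    U y /\ `|f y - f z - \sum_k partial k f x * (y 0 k - z 0 k)|
      <= e * \sum_k `|y 0 k - z 0 k|.
Proof.
move=> Cf Ux e0; have [d d0 dP] := partial_close Cf Ux e0.
exists d => // y z yd zd; split; first by have [] := dP y yd.
(* The first [m] coordinates come from [y], the others from [z]; every such point stays in the
   cube. *)
pose w (m : nat) : 'rV[R]_n := \row_j if (j < m)%N then y 0 j else z 0 j.
have wd m i : `|w m 0 i - x 0 i| < d by rewrite mxE; case: ifP.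
have w0 : w 0%N = z by apply/rowP => j; rewrite mxE.
have wn : w n = y by apply/rowP => j; rewrite mxE ltn_ord.
have wS (k : 'I_n) : w k.+1 = (y 0 k - z 0 k) *: delta_mx 0 k + w k.
  apply/rowP => j; rewrite !mxE eqxx/= ltnS.
  have [->|jk] := eqVneq j k; first by rewrite ltnn leqnn mulr1 subrK.
  by rewrite mulr0 add0r ltn_neqAle jk.
have -> : f y - f z = \sum_(k < n) (f (w k.+1) - f (w k)).
  by rewrite -(big_mkord predT (fun k => f (w k.+1) - f (w k))) telescope_sumr// w0 wn.
rewrite -sumrB mulr_sumr; apply: le_trans (ler_norm_sum _ _ _) _.
apply: ler_sum => k _; rewrite wS.
apply: (@partial_increment f k x d e (partial k f x)) => //.
- move=> v vd; have [Uv /(_ k)] := dP v vd; split => //.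
  by have [] := Ck_derivable k Cf Uv.
- by move=> i; rewrite -wS.
Qed.

Lemma C1_lipschitz f x : Ck 1 U f -> U x -> exists2 d : R, 0 < d &
  exists2 C : R, 0 <= C & forall y z (m : R), (forall i, `|y 0 i - x 0 i| < d) ->
    (forall i, `|z 0 i - x 0 i| < d) -> (forall i, `|y 0 i - z 0 i| <= m) ->
    `|f y - f z| <= C * m.
Proof.
move=> Cf Ux; have [d d0 dP] := strict_derivative Cf Ux ltr01.
exists d => //; exists (\sum_k (`|partial k f x| + 1)).
  by apply: sumr_ge0 => k _; rewrite addr_ge0.
move=> y z m yd zd yz; have [_] := dP y z yd zd; rewrite mul1r => H.
set S := \sum_k partial k f x * (y 0 k - z 0 k) in H.
have -> : f y - f z = (f y - f z - S) + S by rewrite subrK.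
apply: le_trans (ler_normD _ _) _; apply: le_trans (lerD H (ler_norm_sum _ _ _)) _.
rewrite -big_split mulr_suml/=; apply: ler_sum => k _.
by rewrite normrM addrC -{2}[`|y 0 k - _|]mul1r -mulrDl ler_wpM2l// addr_ge0.
Qed.

Lemma chain_rule_line (f : 'rV[R]_n -> R) (X : R -> 'rV[R]_n) (dX : 'I_n -> R) :
  Ck 1 U f -> U (X 0) ->
  (forall i, is_derive (0 : R) (1 : R) (fun t => X t 0 i) (dX i)) ->
  is_derive (0 : R) (1 : R) (fun t => f (X t)) (\sum_i partial i f (X 0) * dX i).
Proof.
move=> Cf UX hX.
pose q i (h : R) := h^-1 * (X h 0 i - X 0 0 i).
have qE i : q i h @[h --> 0^'] --> dX i.
  have [dXi <-] := hX i.
  have -> : q i = (fun h : R => h^-1 *: (((fun t => X t 0 i) \o shift 0) (h *: 1) - X 0 0 i)).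
    by apply/funext => h; rewrite /q/= [h *: 1]mulr1 addr0.
  exact: dXi.
have cX i : X h 0 i @[h --> 0^'] --> X 0 0 i.
  have [dXi _] := hX i.
  have /derivable1_diffP/differentiable_continuous/continuous_withinNx := dXi.
  exact.
suff H : h^-1 * (f (X h) - f (X 0)) @[h --> 0^'] --> \sum_i partial i f (X 0) * dX i.
  have E : (fun h : R => h^-1 *: (((fun t => f (X t)) \o shift 0) (h *: 1) - f (X 0))) =
      (fun h : R => h^-1 * (f (X h) - f (X 0))).
    by apply/funext => h; rewrite /= [h *: 1]mulr1 addr0.
  apply: DeriveDef; rewrite /derivable /derive E; last exact/cvg_lim.
  by apply/cvg_ex; exists (\sum_i partial i f (X 0) * dX i).
have sE : \sum_i partial i f (X 0) * q i h @[h --> 0^'] --> \sum_i partial i f (X 0) * dX i.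
  apply: cvg_big => [|i _]; first exact: add_continuous.
  by apply: cvgMl_tmp; exact: qE.
apply/cvgrPdist_le => eta eta0.
(* Near 0 each difference quotient is at most [|dX i| + 1], so [S] bounds their sum; the leading 1
   keeps [S] positive when [n] is 0. *)
pose S := 1 + \sum_i (`|dX i| + 1).
have S0 : 0 < S by rewrite ltr_pwDl// sumr_ge0// => i _; rewrite addr_ge0.
pose e := eta / 2 / S.
have e0 : 0 < e by rewrite !divr_gt0.
have [d d0 dP] := strict_derivative Cf UX e0.
have nd : \forall h \near 0^', forall i, `|X h 0 i - X 0 0 i| < d.
  apply: filter_forall => i.
  have /cvgrPdist_lt/(_ d d0) := cX i.
  by apply: filterS => h; rewrite distrC.
have nq : \forall h \near 0^', forall i, `|q i h| <= `|dX i| + 1.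
  apply: filter_forall => i.
  have /cvgrPdist_le/(_ 1 ltr01) := qE i.
  apply: filterS => h H; rewrite -[q i h](subrK (dX i)) addrC.
  by apply: le_trans (ler_normD _ _) _; rewrite lerD2l distrC.
near=> h.
have h0 : h != 0 by near: h; exact: nbhs_dnbhs_neq.
have hd i : `|X h 0 i - X 0 0 i| < d by move: i; near: h.
have hq i : `|q i h| <= `|dX i| + 1 by move: i; near: h.
have hs : `|\sum_i partial i f (X 0) * dX i - \sum_i partial i f (X 0) * q i h| <= eta / 2.
  by near: h; have /cvgrPdist_le := sE; apply; rewrite divr_gt0.
have [|_ H] := dP (X h) (X 0) hd; first by move=> i; rewrite subrr normr0.
have H' : `|h^-1 * (f (X h) - f (X 0)) - \sum_i partial i f (X 0) * q i h| <= eta / 2.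
  have -> : h^-1 * (f (X h) - f (X 0)) - \sum_i partial i f (X 0) * q i h =
    h^-1 * (f (X h) - f (X 0) - \sum_k partial k f (X 0) * (X h 0 k - X 0 0 k)).
    rewrite [RHS]mulrBr mulr_sumr; congr (_ - _); apply: eq_bigr => i _.
    by rewrite /q mulrCA.
  rewrite normrM; apply: le_trans (ler_wpM2l (normr_ge0 _) H) _.
  rewrite mulrCA mulr_sumr.
  under eq_bigr do rewrite -normrM -/(q _ _).
  have -> : eta / 2 = e * S by rewrite divfK// gt_eqF.
  rewrite ler_wpM2l ?(ltW e0)//.
  by apply: le_trans (ler_sum _ (fun i _ => hq i)) _; rewrite /S lerDr.
rewrite [eta]splitr.
have -> : \sum_i partial i f (X 0) * dX i - h^-1 * (f (X h) - f (X 0)) =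
  (\sum_i partial i f (X 0) * dX i - \sum_i partial i f (X 0) * q i h)
  - (h^-1 * (f (X h) - f (X 0)) - \sum_i partial i f (X 0) * q i h) by ring.
by apply: le_trans (ler_normB _ _) _; exact: lerD.
Unshelve. all: by end_near. Qed.

Lemma chain_rule (V : normedModType R) f (X : V -> 'rV[R]_n) (dX : 'I_n -> R) p v :
  Ck 1 U f -> U (X p) ->
  (forall i, is_derive p v (fun q => X q 0 i) (dX i)) ->
  is_derive p v (fun q => f (X q)) (\sum_i partial i f (X p) * dX i).
Proof.
move=> Cf UX hX; apply/is_derive_along.
have E : X p = X (0 *: v + p) by rewrite scale0r add0r.
rewrite E; apply: (@chain_rule_line f (fun t => X (t *: v + p))) => //.
  by rewrite -E.
by move=> i; apply/is_derive_along.
Qed.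

End ChainRule.

(** * The Picard-Lindelof theorem *)

Section Picard.
Variable R : realType.
Implicit Types (f g : R -> R) (s t r : R).

(** Integration starts at -1 so that 0 is interior. The interval of radius 1 suffices because the
    time of existence in [picard] is below 1. *)
Lemma primitive_exists f : (forall x, {for x, continuous f}) ->
  exists P : R -> R, P 0 = 0 /\
    forall t, `|t| < 1 -> is_derive t (1 : R) P (f t).
Proof.
move=> cf.
pose Q (x : R) := (\int[lebesgue_measure]_(t in [set` `[(-1 : R), x]]) (f t))%R.
exists (fun x => Q x - Q 0); rewrite subrr; split => // t; rewrite ltr_norml => /andP[t1 t2].
have fi : (@lebesgue_measure R).-integrable `[(-1 : R), 1] (EFin \o f).
  apply: continuous_compact_integrable; first exact: segment_compact.
  by apply: continuous_subspaceT => x; exact: cf.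
have [dQ Q'] := continuous_FTC1_closed t2 fi t1 (cf t).
have dQt : is_derive t (1 : R) Q (f t) by apply: DeriveDef => //; rewrite -derive1E.
by have := is_derive_sub dQt (is_derive_const (Q 0) t (1 : R)); rewrite subr0.
Qed.

Lemma lipschitz_of_derivative f (df : R -> R) (K s t : R) :
  (forall u, `|u| < 1 -> is_derive u (1 : R) f (df u)) ->
  (forall u, `|u| < 1 -> `|df u| <= K) -> `|s| < 1 -> `|t| < 1 ->
  `|f s - f t| <= K * `|s - t|.
Proof.
move=> fP dfK; wlog ts : s t / t <= s.
  move=> H s1 t1; have [ts|/ltW st] := leP t s; first exact: H.
  by rewrite distrC [`|s - t|]distrC; exact: H.
rewrite !ltr_norml => /andP[s1 s2] /andP[t1 t2].
have I u : t <= u <= s -> `|u| < 1 by rewrite ltr_norml => /andP[? ?]; lra.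
have [||u] := @MVT_segment R f df t s ts.
- move=> u; rewrite in_itv/= => /andP[tu us]; apply: fP; apply: I.
  by rewrite !ltW.
- apply: derivable_within_continuous => u; rewrite in_itv/= => /I/fP[] //.
- rewrite in_itv/= => /I uI ->; rewrite normrM ler_wpM2r//; exact: dfK.
Qed.

Definition clamp r t : R := Num.max (- r) (Num.min t r).

Lemma clamp_id r t : `|t| <= r -> clamp r t = t.
Proof.
by rewrite ler_norml /clamp => /andP[t1 t2]; rewrite min_l// max_r.
Qed.

Lemma clamp_bound r t : 0 <= r -> `|clamp r t| <= r.
Proof.
move=> r0; rewrite ler_norml /clamp le_max lexx/= ge_max ge_min lexx orbT andbT.
lra.
Qed.

Lemma clamp_lipschitz r s t : `|clamp r s - clamp r t| <= `|s - t|.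
Proof.
wlog ts : s t / t <= s.
  move=> H; have [ts|/ltW st] := leP t s; first exact: H.
  by rewrite distrC [`|s - t|]distrC; exact: H.
rewrite [X in _ <= X]ger0_norm ?subr_ge0// /clamp ler_norml.
case: (leP t r) => ?; case: (leP s r) => ?; rewrite !maxEle;
  by do ![case: ifPn; rewrite -?ltNge => ?]; apply/andP; split; lra.
Qed.

(** Nested intervals: around [u m] the radius 2K/2^m drops by exactly K/2^m from one step to the
    next, which is the distance that [u] may move. The limit is the supremum of the left
    endpoints. *)
Lemma geometric_cauchy (u : nat -> R) (K : R) :
  (forall m, `|u m.+1 - u m| <= K / 2 ^+ m) ->
  exists l : R, forall m, `|l - u m| <= 2 * K / 2 ^+ m.
Proof.
move=> uK.
pose a m := u m - 2 * K / 2 ^+ m; pose b m := u m + 2 * K / 2 ^+ m.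
have p0 m : (2 ^+ m : R) != 0 by rewrite expf_neq0.
have step m : a m <= a m.+1 /\ b m.+1 <= b m.
  have : 2 * K / 2 ^+ m.+1 = K / 2 ^+ m by rewrite exprS -mulf_div divff// mul1r.
  have := uK m; rewrite /a /b ler_norml => /andP[? ?] ->.
  have -> : 2 * K / 2 ^+ m = K / 2 ^+ m + K / 2 ^+ m by ring.
  by split; lra.
have ma p m : (p <= m)%N -> a p <= a m.
  by move/subnKC <-; elim: (m - p)%N => [|k IH]; rewrite ?addn0//
    addnS (le_trans IH)//; have [] := step (p + k)%N.
have mb p m : (p <= m)%N -> b m <= b p.
  by move/subnKC <-; elim: (m - p)%N => [|k IH]; rewrite ?addn0//
    addnS (le_trans _ IH)//; have [] := step (p + k)%N.
have ab m : a m <= b m.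
  have K0 : 0 <= K by have := le_trans (normr_ge0 _) (uK 0%N); rewrite expr0 divr1.
  by have : 0 <= 2 * K / 2 ^+ m; [rewrite divr_ge0 ?mulr_ge0 ?exprn_ge0|rewrite /a /b => ?; lra].
have apb p m : a p <= b m.
  apply: le_trans (ma p (maxn p m) (leq_maxl _ _)) _.
  exact: le_trans (ab _) (mb m (maxn p m) (leq_maxr _ _)).
have hs : has_sup (range a).
  by split; [exists (a 0%N); exists 0%N|exists (b 0%N) => _ [p _ <-]].
exists (sup (range a)) => m.
have h1 : a m <= sup (range a) by apply: sup_upper_bound => //; exists m.
have h2 : sup (range a) <= b m by apply: sup_le_ub; [case: hs|move=> _ [p _ <-]].
by move: h1 h2; rewrite ler_norml /a /b => ? ?; apply/andP; split; lra.
Qed.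

Lemma le_geometric (a b C : R) : (forall m, a <= b + C / 2 ^+ m) -> a <= b.
Proof.
move=> H; apply/ler_addgt0Pr => e e0.
have [C0|C0] := leP C 0.
  have := H 0%N; rewrite expr0 divr1; lra.
pose m := Num.bound (C / e).
apply: le_trans (H m) _; rewrite lerD2l ler_pdivrMr ?exprn_gt0//.
rewrite mulrC -ler_pdivrMr//.
have := archi_boundP (ltW (divr_gt0 C0 e0)); rewrite -/m => /ltW/le_trans; apply.
by rewrite -natrX ler_nat ltnW// ltn_expl.
Qed.

Variables (I : Type) (F : (I -> R) -> I -> R) (K L : R) (y0 : I -> R).
Hypothesis F_bounded : forall u i, `|F u i| <= K.
Hypothesis F_lipschitz : forall u v m, 0 <= m -> (forall i, `|u i - v i| <= m) ->
  forall i, `|F u i - F v i| <= L * m.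
Hypothesis (K0 : 0 <= K) (L0 : 0 <= L).

Lemma picard : exists2 r : R, 0 < r & exists y : R -> I -> R,
  [/\ y 0 = y0, forall i s t, `|y s i - y t i| <= K * `|s - t|
    & forall t, `|t| < r -> forall i,
        is_derive t (1 : R) (fun s => y s i) (F (y t) i)].
Proof.
(* This radius gives [L * r <= 1/2], hence a contraction by one half, and [r < 1], hence the
   existence of primitives. *)
pose r : R := (2 * (L + 1))^-1.
have L1 : 0 < L + 1 by rewrite ltr_wpDl.
have r0 : 0 < r by rewrite invr_gt0 mulr_gt0.
have Lr : L * r <= 2^-1.
  rewrite /r ler_pdivrMr ?mulr_gt0// mulrA mulVf// mul1r lerDl//.
have r1 : r < 1.
  by rewrite /r invf_lt1 ?mulr_gt0// mulrDr mulr1 ltr_wpDl ?mulr_ge0 ?ltr1n.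
have cl1 t : `|clamp r t| < 1 by apply: le_lt_trans (clamp_bound _ (ltW r0)) r1.
have z1 : `|0 : R| < 1 by rewrite normr0.
(* A primitive is chosen for every function, with [f] itself as a dummy value when it is not
   continuous; thus [T] is defined on all curves, and its properties are claimed only for Lipschitz
   ones. *)
have prim_ex (f : R -> R) : exists P : R -> R,
    (forall x, {for x, continuous f}) -> P 0 = 0 /\
    forall t, `|t| < 1 -> is_derive t (1 : R) P (f t).
  have [cf|ncf] := pselect (forall x, {for x, continuous f}); last by exists f.
  by have [P PP] := primitive_exists cf; exists P.
have [prim primP] := choice prim_ex.
pose lip (y : R -> I -> R) := forall i s t, `|y s i - y t i| <= K * `|s - t|.
have cF y i : lip y -> forall x, {for x, continuous (fun s => F (y s) i)}.
  move=> ly x; apply/cvgrPdist_le => e e0.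
  near=> t; apply: (@le_trans _ _ (L * (K * `|x - t|))).
    by apply: F_lipschitz => [|j]; [exact: mulr_ge0|exact: ly].
  rewrite mulrA -[e](@divfK _ (L * K + 1)); last by rewrite gt_eqF// ltr_pwDr// mulr_ge0.
  rewrite [X in _ <= X]mulrC ler_pM//; first by rewrite mulr_ge0.
    by rewrite lerDl.
  near: t; apply: cvgr_dist_le; first exact: cvg_id.
  by rewrite divr_gt0// ltr_pwDr// mulr_ge0.
(* Time is clamped, so iterates live on the whole line and are constant outside [-r, r]; estimates
   then hold for all times at once. *)
pose T (y : R -> I -> R) t i := y0 i + prim (fun s => F (y s) i) (clamp r t).
have Tlip y : lip y -> lip (T y).
  move=> ly i s t; have [_ pP] := primP _ (cF y i ly).
  rewrite /T opprD addrACA subrr add0r.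
  apply: le_trans (lipschitz_of_derivative pP _ _ _) _; rewrite ?cl1//.
  by rewrite ler_wpM2l// clamp_lipschitz.
have contr y z m : lip y -> lip z -> (forall t i, `|y t i - z t i| <= m) ->
    forall t i, `|T y t i - T z t i| <= m / 2.
  move=> ly lz yz t i; have [py0 pyP] := primP _ (cF y i ly).
  have [pz0 pzP] := primP _ (cF z i lz).
  have m0 : 0 <= m by exact: le_trans (normr_ge0 _) (yz 0 i).
  rewrite /T opprD addrACA subrr add0r.
  have := @lipschitz_of_derivative (fun t => prim (fun s => F (y s) i) t -
     prim (fun s => F (z s) i) t) (fun t => F (y t) i - F (z t) i) (L * m)
     (clamp r t) 0 (fun u u1 => is_derive_sub (pyP u u1) (pzP u u1)).
  rewrite py0 pz0 !subr0 => /(_ (fun u _ => F_lipschitz m0 (fun j => yz u j) i) (cl1 t) z1).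
  move=> /le_trans; apply.
  apply: (@le_trans _ _ (L * m * r)); first by rewrite ler_wpM2l ?mulr_ge0// clamp_bound// ltW.
  by rewrite mulrAC mulrC ler_wpM2l.
pose Y m := iter m T (fun _ => y0).
have Ylip m : lip (Y m).
  elim: m => [|m IH]; last exact: Tlip.
  by move=> i s t; rewrite subrr normr0 mulr_ge0.
have Ystep m t i : `|Y m.+1 t i - Y m t i| <= K / 2 ^+ m.
  elim: m t i => [|m IH] t i.
    rewrite expr0 divr1 /= /T addrC addKr.
    have [p0 pP] := primP _ (cF (Y 0%N) i (Ylip 0%N)).
    have := lipschitz_of_derivative pP (fun u _ => F_bounded (Y 0%N u) i) (cl1 t) z1.
    rewrite p0 !subr0 => /le_trans; apply.
    by rewrite -[X in _ <= X]mulr1 ler_wpM2l// ltW.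
  have := contr _ _ _ (Ylip m.+1) (Ylip m) IH t i.
  by rewrite exprSr invfM mulrA.
have [y yP] := choice (fun p : R * I =>
  geometric_cauchy (fun m => Ystep m p.1 p.2)).
pose z t i := y (t, i).
have zY t i m : `|z t i - Y m t i| <= 2 * K / 2 ^+ m := yP (t, i) m.
have lz : lip z.
  move=> i s t; apply: (@le_geometric _ _ (4 * K)) => m.
  have -> : z s i - z t i = (z s i - Y m s i) + (Y m s i - Y m t i) - (z t i - Y m t i) by ring.
  apply: le_trans (ler_normB _ _) _.
  apply: le_trans (lerD (ler_normD _ _) (zY t i m)) _.
  have := zY s i m; have := Ylip m i s t => h1 h2.
  have -> : 4 * K / 2 ^+ m = 2 * K / 2 ^+ m + 2 * K / 2 ^+ m by ring.
  by rewrite addrA lerD2r addrC lerD.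
(* The two errors are 2K/2^m halved by the contraction, and 2K/2^(m+1); their sum 2K/2^m tends to
   0. *)
have Tz t i : T z t i = z t i.
  apply/eqP; rewrite -subr_eq0 -normr_le0; apply: (@le_geometric _ _ (2 * K)) => m.
  rewrite add0r.
  have -> : T z t i - z t i = (T z t i - T (Y m) t i) - (z t i - Y m.+1 t i) by rewrite /=; ring.
  apply: le_trans (ler_normB _ _) _.
  apply: le_trans (lerD (contr _ _ _ lz (Ylip m) (fun t i => zY t i m) t i) (zY t i m.+1)) _.
  by rewrite exprSr invfM !mulrA -splitr.
exists r => //; exists z; split => //.
- apply/funext => i; rewrite -Tz /T clamp_id ?normr0 ?ltW//.
  by have [-> _] := primP _ (cF z i lz); rewrite addr0.
- move=> t tr i; have [_ pP] := primP _ (cF z i lz).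
  have t1 : `|t| < 1 by exact: lt_trans tr r1.
  have H : is_derive t (1 : R) (fun s => y0 i + prim (fun s => F (z s) i) s) (F (z t) i).
    by have := is_derive_add (is_derive_const (y0 i) t (1 : R)) (pP t t1); rewrite add0r.
  apply: is_derive_near H; near=> s.
  have ts : `|t - s| < r - `|t|.
    by near: s; apply: cvgr_dist_lt; [exact: cvg_id|rewrite subr_gt0].
  rewrite -[RHS]Tz /T clamp_id// ltW// -[s](subKr t).
  by apply: le_lt_trans (ler_normB _ _) _; rewrite -ltrBrDl.
Unshelve. all: by end_near. Qed.

End Picard.

(** * Bounded Lipschitz functions for the uniform distance *)

Section BoundedLipschitz.
Variables (R : realType) (S : Type).
Implicit Types (h : (S -> R) -> R) (u v : S -> R).

(** Boundedness is carried along because it makes products of Lipschitz functions Lipschitz again.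
    The bound [m] on all coordinates replaces a norm on [S -> R]. *)
Definition bounded_lipschitz h : Prop := exists2 C : R, 0 <= C &
  (forall u, `|h u| <= C) /\
  forall u v m, 0 <= m -> (forall i, `|u i - v i| <= m) -> `|h u - h v| <= C * m.

Lemma bounded_lipschitz_opp h : bounded_lipschitz h ->
  bounded_lipschitz (fun u => - h u).
Proof.
move=> [C C0 [hb hl]]; exists C => //; split => [u|u v m m0 uv].
  by rewrite normrN.
by rewrite -opprD normrN; exact: hl.
Qed.

Lemma bounded_lipschitz_mul h k : bounded_lipschitz h -> bounded_lipschitz k ->
  bounded_lipschitz (fun u => h u * k u).
Proof.
move=> [C C0 [hb hl]] [D D0 [kb kl]]; exists (C * D + C * D).
  by rewrite addr_ge0 ?mulr_ge0.
split => [u|u v m m0 uv].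
  by rewrite normrM ler_wpDl ?mulr_ge0// ler_pM.
have -> : h u * k u - h v * k v = h u * (k u - k v) + (h u - h v) * k v by ring.
apply: le_trans (ler_normD _ _) _; rewrite !normrM mulrDl.
apply: lerD; first by rewrite -mulrA ler_pM//; exact: kl.
by rewrite mulrAC ler_pM//; exact: hl.
Qed.

Lemma bounded_lipschitz_sum (J : Type) (r : seq J) (h : J -> (S -> R) -> R) :
  (forall j, bounded_lipschitz (h j)) ->
  bounded_lipschitz (fun u => \sum_(j <- r) h j u).
Proof.
move=> hP; elim: r => [|j r [D D0 [kb kl]]].
  exists 0 => //; split => [u|u v m m0 uv]; rewrite !big_nil ?subrr normr0//.
  by rewrite mul0r.
have [C C0 [hb hl]] := hP j.
exists (C + D); first exact: addr_ge0.
split => [u|u v m m0 uv]; rewrite !big_cons.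
  by apply: le_trans (ler_normD _ _) _; exact: lerD.
rewrite opprD addrACA mulrDl; apply: le_trans (ler_normD _ _) _.
by apply: lerD; [exact: hl|exact: kl].
Qed.

Lemma bounded_lipschitz_clamp (i : S) (c r : R) : 0 <= r ->
  bounded_lipschitz (fun u => c + clamp r (u i - c)).
Proof.
(* The sum [|c| + r] is the bound, and the added 1 makes the constant dominate the Lipschitz
   constant of clamping. *)
move=> r0; exists (`|c| + r + 1); first by rewrite !addr_ge0.
split => [u|u v m m0 uv].
  apply: le_trans (ler_normD _ _) _.
  by rewrite -addrA lerD2l ler_wpDr// clamp_bound.
rewrite opprD addrACA subrr add0r.
apply: le_trans (clamp_lipschitz _ _ _) _.
have -> : u i - c - (v i - c) = u i - v i by ring.
apply: le_trans (uv i) _.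
by rewrite ler_peMl// lerDr addr_ge0.
Qed.

Lemma bounded_lipschitz_uniform (I : finType) (G : (S -> R) -> I -> R) :
  (forall i, bounded_lipschitz (G^~ i)) ->
  exists2 C : R, 0 <= C & (forall u i, `|G u i| <= C) /\
  forall u v m, 0 <= m -> (forall i, `|u i - v i| <= m) ->
    forall i, `|G u i - G v i| <= C * m.
Proof.
move=> GP.
have GP' i : exists C : R, 0 <= C /\ ((forall u, `|G u i| <= C) /\
    forall u v m, 0 <= m -> (forall i, `|u i - v i| <= m) -> `|G u i - G v i| <= C * m).
  by have [C C0 P] := GP i; exists C.
have [C CP] := choice GP'.
have Cle i : C i <= \sum_j C j.
  by rewrite (bigD1 i)//= lerDl sumr_ge0// => j _; have [] := CP j.
exists (\sum_j C j); first by apply: sumr_ge0 => j _; have [] := CP j.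
split => [u i|u v m m0 uv i]; have [C0 [hb hl]] := CP i.
  exact: le_trans (hb u) (Cle i).
by apply: le_trans (hl u v m m0 uv) _; rewrite ler_wpM2r.
Qed.

End BoundedLipschitz.

Section GeodesicODE.
Variables (R : realType) (n : nat) (U : set 'rV[R]_n).
Hypothesis Uo : open U.
Variables (Gam : 'I_n -> 'I_n -> 'I_n -> 'rV[R]_n -> R).
Hypothesis Gam_C1 : forall i j k, Ck 1 U (Gam i j k).

Lemma uniform_radius (I : finType) (P : I -> R -> Prop) :
  (forall i d e, e <= d -> P i d -> P i e) ->
  (forall i, exists2 d : R, 0 < d & P i d) ->
  exists2 d : R, 0 < d & forall i, P i d.
Proof.
move=> Ple Pex.
have Pex' i : exists d : R, 0 < d /\ P i d by have [d] := Pex i; exists d.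
have [d dP] := choice Pex'.
exists (\big[Num.min/1]_i d i).
  by apply/bigmin_gtP; split => // i _; have [] := dP i.
move=> i; have [_ Pd] := dP i; apply: Ple Pd.
exact: bigmin_le_cond.
Qed.

(* Clamping position and velocity around the initial data makes the vector field
   globally bounded and Lipschitz without changing it near these data. *)
Lemma geodesic_ode (x0 v0 : 'rV[R]_n) : U x0 ->
  exists2 r : R, 0 < r & exists x v : R -> 'rV[R]_n,
    [/\ x 0 = x0, v 0 = v0 & forall t, `|t| < r ->
      [/\ U (x t), forall i, is_derive t (1 : R) (fun s => x s 0 i) (v t 0 i)
        & forall i, is_derive t (1 : R) (fun s => v s 0 i)
            (- \sum_j \sum_k Gam i j k (x t) * v t 0 j * v t 0 k)]].
Proof.
move=> Ux0.
have [d0 d00 d0P] : exists2 d : R, 0 < d &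
    forall y : 'rV[R]_n, (forall i, `|y 0 i - x0 0 i| < d) -> U y.
  have /nbhs_ballP[d /= dpos dP] := open_nbhs_nbhs (conj Uo Ux0).
  exists d => // y yd; apply: dP; split => // i j.
  by rewrite ord1 /ball/= distrC; exact: yd.
have [d dpos dP] : exists2 d : R, 0 < d & forall ijk : 'I_n * 'I_n * 'I_n,
    exists2 C : R, 0 <= C & forall (y z : 'rV[R]_n) (m : R),
    (forall i, `|y 0 i - x0 0 i| < d) -> (forall i, `|z 0 i - x0 0 i| < d) ->
    (forall i, `|y 0 i - z 0 i| <= m) ->
    `|Gam ijk.1.1 ijk.1.2 ijk.2 y - Gam ijk.1.1 ijk.1.2 ijk.2 z| <= C * m.
  apply: uniform_radius => [ijk d e ed [C C0 CP]|ijk].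
    by exists C => // y z m ye ze; apply: CP => i; exact: lt_le_trans ed.
  exact: (C1_lipschitz Uo (Gam_C1 ijk.1.1 ijk.1.2 ijk.2) Ux0).
(* Half of [d] keeps clamped positions strictly inside the cube where the estimates for [Gam]
   hold. *)
pose rho := d / 2.
have rho0 : 0 < rho by rewrite divr_gt0.
have rhod : rho < d by rewrite /rho ltr_pdivrMr// ltr_pMr// ltr1n.
(* The second-order equation becomes a first-order one on pairs: left indices are positions, right
   indices are velocities. *)
pose X (u : 'I_n + 'I_n -> R) : 'rV[R]_n :=
  \row_i (x0 0 i + clamp rho (u (inl i) - x0 0 i)).
pose W (u : 'I_n + 'I_n -> R) i : R := v0 0 i + clamp 1 (u (inr i) - v0 0 i).
pose F (u : 'I_n + 'I_n -> R) (a : 'I_n + 'I_n) : R := match a with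
  | inl i => W u i
  | inr i => - \sum_j \sum_k Gam i j k (X u) * W u j * W u k end.
have Xd u i : `|X u 0 i - x0 0 i| < d.
  by rewrite mxE addrC addKr; apply: le_lt_trans rhod; rewrite clamp_bound ?ltW.
have blW i : bounded_lipschitz (W^~ i) by exact: bounded_lipschitz_clamp.
have blG i j k : bounded_lipschitz (fun u => Gam i j k (X u)).
  have [C C0 /= CP] := dP (i, j, k).
  exists (`|Gam i j k x0| + C * rho + C); first by rewrite !addr_ge0 ?mulr_ge0// ltW.
  have x0d a : `|x0 0 a - x0 0 a| < d by rewrite subrr normr0.
  split => [u|u v m m0 uv].
    rewrite -[Gam i j k (X u)](subrK (Gam i j k x0)) addrC.
    apply: le_trans (ler_normD _ _) _; rewrite -addrA lerD2l ler_wpDr//.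
    apply: CP => // a; rewrite mxE addrC addKr clamp_bound// ltW//.
  apply: (@le_trans _ _ (C * m)); last first.
    by rewrite ler_wpM2r// lerDr addr_ge0 ?mulr_ge0// ltW.
  apply: CP => // a; rewrite !mxE opprD addrACA subrr add0r.
  apply: le_trans (clamp_lipschitz _ _ _) _.
  have -> : u (inl a) - x0 0 a - (v (inl a) - x0 0 a) = u (inl a) - v (inl a) by ring.
  exact: uv.
have [K K0 [FK FL]] : exists2 C : R, 0 <= C & (forall u a, `|F u a| <= C) /\
    forall u v m, 0 <= m -> (forall i, `|u i - v i| <= m) ->
    forall i, `|F u i - F v i| <= C * m.
  apply: bounded_lipschitz_uniform => -[i|i] /=; first exact: blW.
  apply: bounded_lipschitz_opp; apply: bounded_lipschitz_sum => j.
  apply: bounded_lipschitz_sum => k; do !apply: bounded_lipschitz_mul => //.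
pose y0 (a : 'I_n + 'I_n) : R := match a with inl i => x0 0 i | inr i => v0 0 i end.
have [r r0 [y [yz ylip yder]]] := picard y0 FK FL K0 K0.
(* The solution is [K]-Lipschitz, so before time [e] each coordinate moves by at most [K * e]. The
   bounds make both clamps inactive and keep the position in [U]. *)
have [e e0 [eK1 eK2 eK3 er]] : exists2 e : R, 0 < e &
    [/\ K * e <= rho, K * e <= 1, K * e < d0 & e <= r].
  pose e := Num.min r (Num.min rho (Num.min 1 (d0 / 2)) / (K + 1)).
  have K1 : 0 < K + 1 by rewrite ltr_wpDl.
  have e0 : 0 < e by rewrite /e !lt_min r0 divr_gt0// !lt_min rho0 ltr01 divr_gt0.
  have Ke : K * e <= Num.min rho (Num.min 1 (d0 / 2)).
    apply: (@le_trans _ _ ((K + 1) * e)); first by rewrite ler_wpM2r ?lerDl// ltW.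
    by rewrite mulrC -ler_pdivlMr// /e ge_min lexx orbT.
  move: (Ke); rewrite !le_min => /andP[h1 /andP[h2 h3]].
  exists e => //; split => //; last by rewrite /e ge_min lexx.
  by apply: le_lt_trans h3 _; rewrite ltr_pdivrMr// ltr_pMr// ltr1n.
have near0 t a : `|t| < e -> `|y t a - y0 a| <= K * e.
  move=> te; have := ylip a t 0; rewrite yz subr0 => /le_trans; apply.
  by rewrite ler_wpM2l// ltW.
exists e => //.
exists (fun t => \row_i y t (inl i)), (fun t => \row_i y t (inr i)).
split; [by apply/rowP => i; rewrite mxE yz|by apply/rowP => i; rewrite mxE yz|].
move=> t te.
have XE : X (y t) = \row_i y t (inl i).
  apply/rowP => i; rewrite !mxE clamp_id; first by rewrite addrC subrK.
  exact: le_trans (near0 t (inl i) te) eK1.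
have WE i : W (y t) i = y t (inr i).
  rewrite /W clamp_id; first by rewrite addrC subrK.
  exact: le_trans (near0 t (inr i) te) eK2.
have tr : `|t| < r by exact: lt_le_trans te er.
split.
- apply: d0P => i; rewrite mxE; apply: le_lt_trans eK3.
  exact: near0 t (inl i) te.
- move=> i; have := yder t tr (inl i); rewrite /= WE mxE.
  by congr is_derive; apply/funext => s; rewrite mxE.
- move=> i; have := yder t tr (inr i); rewrite /= XE.
  under eq_bigr do under eq_bigr do rewrite !WE.
  have -> : (fun s => (\row_i0 y s (inr i0)) 0 i) = (fun s => y s (inr i)).
    by apply/funext => s; rewrite mxE.
  by under [in X in _ -> X]eq_bigr do under eq_bigr do
    rewrite [(\row_i1 y t (inr i1)) 0 _]mxE [(\row_i1 y t (inr i1)) 0 _]mxE.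
Qed.

End GeodesicODE.

(** * The Killing form of so(g) *)

Section TraceOnSubspace.
Variables (R : realType) (n : nat).
Implicit Types (A B Z : 'M[R]_n).

Lemma mul_delta_mul A B i j k l :
  (A *m delta_mx i j *m B) k l = A k i * B j l.
Proof.
rewrite mxE (bigD1 j)//= big1 ?addr0 => [|a aj].
  rewrite mxE (bigD1 i)//= big1 ?addr0 => [|a ai].
    by rewrite mxE !eqxx mulr1.
  by rewrite mxE (negbTE ai) mulr0.
by rewrite mxE big1 ?mul0r// => b _; rewrite mxE (negbTE aj) andbF mulr0.
Qed.

(** The left side is the trace of the endomorphism Z -> A Z B in the basis of elementary matrices;
    the next lemma does the same for Z -> A Z^T B. *)
Lemma trace_mul_delta A B :
  \sum_i \sum_j (A *m delta_mx i j *m B) i j = \tr A * \tr B.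
Proof.
rewrite mulr_suml; apply: eq_bigr => i _; rewrite mulr_sumr.
by apply: eq_bigr => j _; rewrite mul_delta_mul.
Qed.

Lemma trace_mul_delta_tr A B :
  \sum_i \sum_j (A *m (delta_mx i j)^T *m B) i j = \tr (A *m B^T).
Proof.
apply: eq_bigr => i _; rewrite mxE; apply: eq_bigr => j _.
by rewrite trmx_delta mul_delta_mul mxE.
Qed.

(** When [P] projects onto a subspace [L] stable under [T], the composite T P has its image in [L]
    and restricts to [T] there, so its trace on all matrices is that of [T] on [L]. This avoids any
    explicit basis of [so g]. *)
Lemma trace_on_subspace (L : {vspace 'M[R]_n}) (P T : {linear 'M[R]_n -> 'M[R]_n}) :
  (forall Z, P Z \in L) -> (forall Z, Z \in L -> P Z = Z) ->
  (forall Z, Z \in L -> T Z \in L) ->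
  \sum_(i < \dim L) coord (vbasis L) i (T (vbasis L)`_i) =
  \sum_i \sum_j (T (P (delta_mx i j))) i j.
Proof.
move=> PL PK TL.
have decomp Z : T (P Z) = \sum_k coord (vbasis L) k (P Z) *: T (vbasis L)`_k.
  rewrite {1}(coord_vbasis (PL Z)) linear_sum; apply: eq_bigr => k _.
  by rewrite linearZ.
under [RHS]eq_bigr do under eq_bigr do rewrite decomp summxE.
under [RHS]eq_bigr do rewrite exchange_big/=.
rewrite [RHS]exchange_big/=; apply: eq_bigr => k _.
have bL : (vbasis L)`_k \in L by apply/vbasis_mem/mem_nth; rewrite size_tuple.
(* The image of the basis vector lies in [L] and is fixed by [P]; expanding this image in elementary
   matrices puts [P] on them. *)
rewrite -{1}(PK _ (TL _ bL)) {1}[T _]matrix_sum_delta !linear_sum/=.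
apply: eq_bigr => i _; rewrite !linear_sum/=; apply: eq_bigr => j _.
by rewrite !linearZ/= mxE mulrC.
Qed.

End TraceOnSubspace.

Section KillingForm.
Variables (R : realType) (n : nat) (g : 'M[R]_n).
Hypotheses (g_sym : g^T = g) (g_unit : g \in unitmx).
Implicit Types (X Y Z : 'M[R]_n).

Lemma lie_is_linear X : linear (lie X).
Proof.
move=> k Y Z; rewrite /lie mulmxDr mulmxDl -scalemxAr -scalemxAl opprD.
by rewrite addrACA -scalerBr.
Qed.

HB.instance Definition _ X :=
  GRing.isLinear.Build R 'M[R]_n 'M[R]_n *:%R (lie X) (lie_is_linear X).

Lemma lie_so X Y : X \in so g -> Y \in so g -> lie X Y \in so g.
Proof.
move=> /soP hX /soP hY; apply/soP.
rewrite /lie linearB/= !trmx_mul mulmxBl mulmxBr -!mulmxA hX hY.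
by rewrite !mulmxN !mulmxA hX hY !mulNmx !opprK opprB.
Qed.

Definition adj X : 'M[R]_n := invmx g *m X^T *m g.

Lemma so_adj X : X \in so g -> adj X = - X.
Proof.
by move=> /soP hX; rewrite /adj -mulmxA hX mulmxN mulmxA mulVmx// mul1mx.
Qed.

(** The projection of all matrices onto [so g] along [Sym g]. *)
Definition skew_part X : 'M[R]_n := 2^-1 *: (X - adj X).

Lemma skew_part_is_linear : linear skew_part.
Proof.
move=> k X Y; rewrite /skew_part /adj linearP/= mulmxDr mulmxDl.
rewrite -scalemxAr -scalemxAl opprD addrACA -scalerBr scalerDr scalerA.
by rewrite [2^-1 * k]mulrC -scalerA.
Qed.

HB.instance Definition _ :=
  GRing.isLinear.Build R 'M[R]_n 'M[R]_n *:%R skew_part skew_part_is_linear.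

Lemma skew_part_so X : skew_part X \in so g.
Proof.
apply/soP; rewrite /skew_part linearZ/= -scalemxAl -scalemxAr -scalerN.
congr (_ *: _); rewrite linearB/= /adj !trmx_mul g_sym trmxK trmx_inv g_sym.
rewrite mulmxBl mulmxBr !mulmxA mulmxV// mul1mx -[g *m X *m _ *m g]mulmxA mulVmx// mulmx1.
by rewrite opprB.
Qed.

Lemma skew_part_id X : X \in so g -> skew_part X = X.
Proof.
move=> hX; rewrite /skew_part so_adj// opprK scalerDr -scalerDl.
by rewrite (_ : 2^-1 + 2^-1 = 1) ?scale1r//; field.
Qed.

Lemma trace_adj X : \tr (adj X) = \tr X.
Proof. by rewrite /adj -mulmxA mxtrace_mulC -mulmxA mulmxV// mulmx1 mxtrace_tr. Qed.

Lemma trace_so X : X \in so g -> \tr X = 0.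
Proof.
move=> hX; have := trace_adj X; rewrite so_adj// linearN/=.
by move=> H; lra.
Qed.

(** By [trace_on_subspace] this is half the trace of ad X ad Y on all matrices, namely 2n tr(XY)
    since X and Y are traceless, minus half the trace of its composite with the adjoint, namely 4
    tr(XY). *)
Lemma killing_so X Y : X \in so g -> Y \in so g ->
  killing (so g) X Y = (n%:R - 2) * \tr (X *m Y).
Proof.
move=> hX hY; rewrite /killing.
rewrite (@trace_on_subspace _ _ (so g) skew_part (lie X \o lie Y))/=; first last.
- by move=> Z hZ; apply: lie_so => //; exact: lie_so.
- exact: skew_part_id.
- exact: skew_part_so.
(* The four terms of the double bracket, padded with identity matrices so that each has the shape A
   Z B of the trace formulas. *)
pose T Z := X *m Y *m Z *m 1%:M - X *m Z *m Y - Y *m Z *m X + 1%:M *m Z *m (Y *m X).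
have TE Z : lie X (lie Y Z) = T Z.
  rewrite /lie /T mulmxBr mulmxBl mulmx1 mul1mx !mulmxA; apply/matrixP => i j.
  by rewrite !mxE; ring.
have addE (A B : 'M[R]_n) i j : (A + B) i j = A i j + B i j by rewrite mxE.
have oppE (A : 'M[R]_n) i j : (- A) i j = - A i j by rewrite mxE.
have S1 : \sum_i \sum_j T (delta_mx i j) i j = 2 * n%:R * \tr (X *m Y).
  transitivity (\tr (X *m Y) * \tr (1%:M : 'M[R]_n) - \tr X * \tr Y - \tr Y * \tr X
    + \tr (1%:M : 'M[R]_n) * \tr (Y *m X)).
    rewrite -!trace_mul_delta -!sumrB -!big_split/=; apply: eq_bigr => i _.
    rewrite -!sumrB -!big_split/=; apply: eq_bigr => j _.
    by rewrite /T !(addE, oppE) !mulmxA.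
  by rewrite mxtrace1 (trace_so hX) (trace_so hY) [\tr (Y *m X)]mxtrace_mulC; ring.
have S2 : \sum_i \sum_j T (adj (delta_mx i j)) i j = 4 * \tr (X *m Y).
  transitivity (\tr (X *m Y *m invmx g *m g^T) - \tr (X *m invmx g *m (g *m Y)^T)
    - \tr (Y *m invmx g *m (g *m X)^T) + \tr (invmx g *m (g *m (Y *m X))^T)).
    rewrite -!trace_mul_delta_tr -!sumrB -!big_split/=; apply: eq_bigr => i _.
    rewrite -!sumrB -!big_split/=; apply: eq_bigr => j _; rewrite /T /adj.
    by rewrite !(addE, oppE) !mulmxA mulmx1 mul1mx.
  have := so_adj hX; have := so_adj hY; rewrite /adj => aY aX.
  rewrite g_sym -[X *m Y *m _ *m g]mulmxA mulVmx// mulmx1 !trmx_mul g_sym.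
  rewrite -![_ *m invmx g *m _]mulmxA ![invmx g *m (_ *m g)]mulmxA aX aY.
  rewrite !mulmxN !linearN/=.
  rewrite -trmx_mul -/(adj (Y *m X)) trace_adj.
  by rewrite [\tr (Y *m X)]mxtrace_mulC; ring.
transitivity (2^-1 * (2 * n%:R * \tr (X *m Y) - 4 * \tr (X *m Y))); last by field.
rewrite -S1 -S2 -sumrB mulr_sumr; apply: eq_bigr => i _; rewrite -sumrB mulr_sumr.
apply: eq_bigr => j _; rewrite /skew_part !linearZ/= mxE; congr (_ * _).
rewrite (linearB (lie Y)) (linearB (lie X)).
have TB A B : (lie X (lie Y A) - lie X (lie Y B)) = T A - T B by rewrite !TE.
by rewrite TB addE oppE.
Qed.

End KillingForm.

(** * Derivatives of matrices and Christoffel symbols *)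

Section MatrixDerivatives.
Variables (R : realType) (V : normedModType R) (x v : V).

(** A relation rather than an operator: identities arise by differentiating one matrix field in two
    ways and comparing through [is_dmx_unique]. *)
Definition is_dmx (p q : nat) (F : V -> 'M[R]_(p, q)) (D : 'M[R]_(p, q)) : Prop :=
  forall i j, is_derive x v (fun y => F y i j) (D i j).

Lemma is_dmx_unique p q (F : V -> 'M[R]_(p, q)) D E :
  is_dmx F D -> is_dmx F E -> D = E.
Proof.
by move=> hD hE; apply/matrixP => i j; have [_ <-] := hD i j; have [_ <-] := hE i j.
Qed.

Lemma is_dmx_near p q (F G : V -> 'M[R]_(p, q)) D :
  (\near x, F x = G x) -> is_dmx F D -> is_dmx G D.
Proof.
move=> FG hF i j; apply: near_eq_is_derive (hF i j).
by apply: filterS FG => y ->.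
Qed.

Lemma is_dmx_const p q (A : 'M[R]_(p, q)) : is_dmx (fun=> A) 0.
Proof. by move=> i j; rewrite mxE; exact: is_derive_const. Qed.

Lemma is_dmx_add p q (F G : V -> 'M[R]_(p, q)) D E : is_dmx F D -> is_dmx G E ->
  is_dmx (fun y => F y + G y) (D + E).
Proof.
move=> hD hE i j; rewrite mxE.
have -> : (fun y => (F y + G y) i j) = (fun y => F y i j + G y i j).
  by apply/funext => y; rewrite mxE.
exact: is_derive_add.
Qed.

Lemma is_dmx_tr p q (F : V -> 'M[R]_(p, q)) D : is_dmx F D ->
  is_dmx (fun y => (F y)^T) D^T.
Proof.
move=> hD i j; rewrite mxE.
have -> : (fun y => (F y)^T i j) = (fun y => F y j i).
  by apply/funext => y; rewrite mxE.
exact: hD.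
Qed.

Lemma is_dmx_row p q (F : V -> 'M[R]_(p, q)) D k : is_dmx F D ->
  is_dmx (fun y => row k (F y)) (row k D).
Proof.
move=> hD i j; rewrite mxE.
have -> : (fun y => (row k (F y)) i j) = (fun y => F y k j).
  by apply/funext => y; rewrite mxE.
exact: hD.
Qed.

Lemma is_dmx_mul p q r (F : V -> 'M[R]_(p, q)) (G : V -> 'M[R]_(q, r)) D E :
  is_dmx F D -> is_dmx G E ->
  is_dmx (fun y => F y *m G y) (D *m G x + F x *m E).
Proof.
move=> hD hE i j.
have -> : (fun y => (F y *m G y) i j) = (fun y => \sum_k F y i k * G y k j).
  by apply/funext => y; rewrite mxE.
rewrite !mxE -big_split/=; apply: is_derive_bigsum => k.
exact: is_derive_prod.
Qed.

Lemma is_dmx_scale p q (f : V -> R) (F : V -> 'M[R]_(p, q)) a D :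
  is_derive x v f a -> is_dmx F D ->
  is_dmx (fun y => f y *: F y) (a *: F x + f x *: D).
Proof.
move=> hf hD i j.
have -> : (fun y => (f y *: F y) i j) = (fun y => f y * F y i j).
  by apply/funext => y; rewrite mxE.
by rewrite !mxE; exact: is_derive_prod.
Qed.

Lemma is_dmx_trace p (F : V -> 'M[R]_p) D : is_dmx F D ->
  is_derive x v (fun y => \tr (F y)) (\tr D).
Proof. by move=> hD; apply: is_derive_bigsum => i; exact: hD. Qed.

(** Obtained by differentiating the constant product of the inverse and [F]. *)
Lemma is_dmx_inv p (F : V -> 'M[R]_p) (D E : 'M[R]_p) :
  (\near x, F x \in unitmx) -> is_dmx F D -> is_dmx (fun y => invmx (F y)) E ->
  E = - (invmx (F x) *m D *m invmx (F x)).
Proof.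
move=> uF hD hE.
have uFx : F x \in unitmx by exact: nbhs_singleton uF.
have H : is_dmx (fun y => invmx (F y) *m F y) 0.
  apply: is_dmx_near (@is_dmx_const _ _ (1%:M : 'M[R]_p)).
  by apply: filterS uF => y Fy; rewrite mulVmx.
have := is_dmx_unique H (is_dmx_mul hE hD) => /eqP.
rewrite eq_sym addr_eq0 => /eqP/(congr1 (fun Z => Z *m invmx (F x))).
by rewrite /= -[E *m _ *m _]mulmxA mulmxV// mulmx1 mulNmx.
Qed.

Lemma is_derive_bigprod (I : eqType) (r : seq I) (f : I -> V -> R) (a : I -> R) :
  uniq r -> (forall i, is_derive x v (f i) (a i)) ->
  is_derive x v (fun y => \prod_(i <- r) f i y)
    (\sum_(i <- r) a i * \prod_(j <- r | j != i) f j x).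
Proof.
move=> + df; elim: r => [|i r IH] /=.
  move=> _; rewrite big_nil.
  have -> : (fun y => \prod_(i <- [::]) f i y) = (fun=> 1).
    by apply/funext => y; rewrite big_nil.
  exact: is_derive_const.
move=> /andP[ir ur].
have -> : (fun y => \prod_(i <- i :: r) f i y) = (fun y => f i y * \prod_(i <- r) f i y).
  by apply/funext => y; rewrite big_cons.
have := is_derive_prod (df i) (IH ur); rewrite big_cons big_cons eqxx/=.
congr is_derive; congr (_ * _ + _).
  rewrite [RHS]big_seq_cond [LHS]big_seq; apply: eq_bigl => j.
  by have [->|] := eqVneq j i; rewrite ?(negbTE ir) ?andbT.
rewrite mulr_sumr [LHS]big_seq [RHS]big_seq; apply: eq_bigr => j jr.
rewrite big_cons; have [ij|_] := eqVneq i j; first by rewrite -ij (negbTE ir) in jr.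
by rewrite mulrCA.
Qed.

(** Jacobi's formula. Both sides equal the sum over i of the determinant of [F x] with row i
    replaced by that of [D]: one by cofactor expansion along this row, the other by the product rule
    in the Leibniz formula. *)
Lemma is_dmx_det p (F : V -> 'M[R]_p) D : is_dmx F D -> F x \in unitmx ->
  is_derive x v (fun y => \det (F y)) (\det (F x) * \tr (invmx (F x) *m D)).
Proof.
move=> hD uF.
have H : is_derive x v (fun y => \sum_(s : 'S_p) (-1) ^+ s * \prod_i F y i (s i))
  (\sum_(s : 'S_p) (0 * \prod_i F x i (s i) +
     (-1) ^+ s * \sum_i D i (s i) * \prod_(j | j != i) F x j (s j))).
  apply: is_derive_bigsum => s.
  apply: (is_derive_prod (is_derive_const ((-1) ^+ s) x v)).
  apply: (@is_derive_bigprod _ (index_enum 'I_p) (fun i y => F y i (s i))) => [|i].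
    exact: index_enum_uniq.
  exact: hD.
have -> : \det (F x) * \tr (invmx (F x) *m D) =
  \sum_(s : 'S_p) (0 * \prod_i F x i (s i) +
     (-1) ^+ s * \sum_i D i (s i) * \prod_(j | j != i) F x j (s j)); last exact: H.
transitivity (\sum_i \det (\matrix_(a, b) if a == i then D a b else F x a b)).
  rewrite -mxtraceZ scalemxAl /invmx uF scalerA divff ?scale1r; last first.
    by rewrite -unitfE -unitmxE.
  rewrite mxtrace_mulC; apply: eq_bigr => i _.
  rewrite mxE (expand_det_row _ i); apply: eq_bigr => j _.
  rewrite !mxE eqxx; congr (_ * _); congr (_ * _); congr (\det _).
  by apply/matrixP => a b; rewrite !mxE eq_sym (negbTE (neq_lift _ _)).
under [RHS]eq_bigr do rewrite mul0r add0r mulr_sumr.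
rewrite [RHS]exchange_big/=; apply: eq_bigr => i _.
apply: eq_bigr => s _; congr (_ * _).
rewrite (bigD1 i)//= mxE eqxx; congr (_ * _); apply: eq_bigr => j ji.
by rewrite mxE (negbTE ji).
Qed.

End MatrixDerivatives.

Section Christoffel.
Variables (R : realType) (n : nat) (U : set 'rV[R]_n).
Variables (G : 'rV[R]_n -> 'M[R]_n).
Hypotheses (Uo : open U) (G_smooth : forall i j, smooth_on U (fun x => G x i j))
  (G_sym : forall x, U x -> (G x)^T = G x)
  (G_unit : forall x, U x -> G x \in unitmx).

(** The connection matrix in direction k: covariant differentiation of a vector field is the partial
    derivative plus multiplication by this matrix. *)
Definition christoffel_mx (k : 'I_n) x : 'M[R]_n :=
  \matrix_(i, j) christoffel G i j k x.

Lemma Ck_partial_smooth m i j k : Ck m U (partial k (fun x => G x i j)).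
Proof. by apply: Ck_partial; exact: G_smooth. Qed.

Lemma Ck_christoffel m i j k : Ck m U (christoffel G i j k).
Proof.
apply: CkZ => //; apply: Ck_sum => // a; apply: CkM => //.
  by apply: Ck_invmx => // b c; exact: G_smooth.
by apply: CkB => //; [apply: CkD => //|]; exact: Ck_partial_smooth.
Qed.

Lemma christoffel_low i j k x : U x ->
  \sum_a G x i a * christoffel G a j k x =
  2^-1 * (partial j (fun y => G y i k) x + partial k (fun y => G y i j) x
     - partial i (fun y => G y j k) x).
Proof.
move=> Ux; under eq_bigr do rewrite mulrCA mulr_sumr.
rewrite -mulr_sumr exchange_big/=; congr (_ * _).
under eq_bigr do under eq_bigr do rewrite mulrA.
under eq_bigr do rewrite -mulr_suml.
have E b : \sum_a G x i a * invmx (G x) a b = (i == b)%:R.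
  transitivity ((1%:M : 'M[R]_n) i b); last by rewrite mxE.
  by rewrite -(mulmxV (G_unit Ux)) mxE.
rewrite (bigD1 i)//= E eqxx mul1r big1 ?addr0// => b bi.
by rewrite E eq_sym (negbTE bi) mul0r.
Qed.

(** Compatibility g_ij,k = 0: in the sum of the lowered symbol and its transpose, only the
    derivative in direction k survives. *)
Lemma is_dmx_metric k x : U x -> is_dmx x (delta_mx 0 k) G
  ((christoffel_mx k x)^T *m G x + G x *m christoffel_mx k x).
Proof.
move=> Ux i j.
have -> : ((christoffel_mx k x)^T *m G x + G x *m christoffel_mx k x) i j =
   partial k (fun y => G y i j) x; last exact: Ck_derivable (G_smooth i j 1) Ux.
have S a b c : partial a (fun y => G y b c) x = partial a (fun y => G y c b) x.
  by apply: (partial_eq Uo) => // y Uy; rewrite -[in LHS](G_sym Uy) mxE.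
have E a b : (G x *m christoffel_mx k x) a b = \sum_c G x a c * christoffel G c b k x.
  by rewrite mxE; apply: eq_bigr => c _; rewrite mxE.
rewrite mxE -[X in X + _](_ : (G x *m christoffel_mx k x)^T i j = _); last first.
  by rewrite trmx_mul G_sym.
by rewrite mxE !E !christoffel_low// (S k j i) (S i j k) (S j i k); field.
Qed.

(** Jacobi's formula applied to metric compatibility; through it the determinants in [a_form] meet
    the traces of the connections, hence phi. *)
Lemma is_derive_det_metric k x : U x ->
  is_derive x (delta_mx 0 k) (fun y => \det (G y))
    (\det (G x) * (2 * \tr (christoffel_mx k x))).
Proof.
move=> Ux; have := is_dmx_det (is_dmx_metric k Ux) (G_unit Ux).
rewrite mulmxDr mxtraceD [\tr (_ *m (_ *m G x))]mxtrace_mulC -mulmxA mulmxV ?G_unit//.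
rewrite mulmx1 mxtrace_tr mulmxA mulVmx ?G_unit// mul1mx.
by rewrite (_ : \tr (christoffel_mx k x) + _ = 2 * \tr (christoffel_mx k x))//; ring.
Qed.

Lemma is_dmx_invmetric k x : U x -> is_dmx x (delta_mx 0 k) (fun y => invmx (G y))
  (- (invmx (G x) *m (christoffel_mx k x)^T + christoffel_mx k x *m invmx (G x))).
Proof.
move=> Ux.
have H : is_dmx x (delta_mx 0 k) (fun y => invmx (G y))
    (\matrix_(i, j) partial k (fun y => invmx (G y) i j) x).
  move=> i j; rewrite mxE; apply: Ck_derivable Ux.
  by apply: (@Ck_invmx _ _ U Uo 1) => // a b; exact: G_smooth.
have nU : \near x, G x \in unitmx.
  by apply: filterS (open_nbhs_nbhs (conj Uo Ux)) => y /G_unit.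
rewrite -[X in - X](_ : invmx (G x) *m ((christoffel_mx k x)^T *m G x + G x *m christoffel_mx k x)
  *m invmx (G x) = _) -?(is_dmx_inv nU (is_dmx_metric k Ux) H)//.
rewrite mulmxDr mulmxDl !mulmxA -[_ *m G x *m invmx (G x)]mulmxA mulmxV ?G_unit//.
by rewrite mulmx1 mulVmx ?G_unit// mul1mx.
Qed.

End Christoffel.

(** * Curvature *)

Section CurvatureAlgebra.
Variables (R : realType) (n : nat).

Lemma addmxE p q (A B : 'M[R]_(p, q)) i j : (A + B) i j = A i j + B i j.
Proof. by rewrite mxE. Qed.

Lemma oppmxE p q (A : 'M[R]_(p, q)) i j : (- A) i j = - A i j.
Proof. by rewrite mxE. Qed.

Lemma trmxD p q (A B : 'M[R]_(p, q)) : (A + B)^T = A^T + B^T.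
Proof. exact: linearD. Qed.

Lemma trmxN p q (A : 'M[R]_(p, q)) : (- A)^T = - A^T.
Proof. exact: linearN. Qed.

Lemma row_add p q i (A B : 'M[R]_(p, q)) : row i (A + B) = row i A + row i B.
Proof. exact: linearD. Qed.

(* Here [K], [L] are the Christoffel matrices in the directions k and l, [Pkl] and
   [Plk] their derivatives, [rk], [rl] rows of the metric and [u] is the gradient of
   lambda with derivatives [dk], [dl]. *)
Lemma integrability_algebra (A K L Pkl Plk : 'M[R]_n) (u dk dl : 'cV[R]_n)
    (rk rl s : 'rV[R]_n) :
  let Dk := K^T *m A + A *m K + (u *m rk + (u *m rk)^T) in
  let Dl := L^T *m A + A *m L + (u *m rl + (u *m rl)^T) in
  let Mlk := dl *m rk + u *m (s + rk *m L) in
  let Mkl := dk *m rl + u *m (s + rl *m K) in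
  Plk^T *m A + K^T *m Dl + (Dl *m K + A *m Plk) + (Mlk + Mlk^T) =
  Pkl^T *m A + L^T *m Dk + (Dk *m L + A *m Pkl) + (Mkl + Mkl^T) ->
  let C := Pkl - Plk + K *m L - L *m K in
  let N := (dl - L^T *m u) *m rk - (dk - K^T *m u) *m rl in
  A *m C + C^T *m A = N + N^T.
Proof.
move=> Dk Dl Mlk Mkl /eqP; rewrite -subr_eq0 => /eqP H C N.
apply/eqP; rewrite -subr_eq0 -oppr_eq0; apply/eqP; rewrite -{}H.
rewrite /C /N /Dk /Dl /Mlk /Mkl.
rewrite !(trmxD, trmxN, trmx_mul, trmxK).
rewrite !(mulmxDl, mulmxDr, mulNmx, mulmxN, mulmxA).
by apply/matrixP => i j; rewrite !(addmxE, oppmxE); ring.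
Qed.

(** The classical argument from four Bianchi identities, one for each choice of the first index.
    Modulo the two skew-symmetries only six components occur, and the claim is a linear
    combination. *)
Lemma pair_symmetry_algebra (Q : 'I_n -> 'I_n -> 'I_n -> 'I_n -> R) i j k l :
  (forall a b c d, Q a b c d = - Q b a c d) ->
  (forall a b c d, Q a b c d = - Q a b d c) ->
  (forall a b c d, Q a b c d + Q a c d b + Q a d b c = 0) ->
  Q i j k l = Q k l i j.
Proof.
move=> s1 s2 B.
have b1 := B i j k l; rewrite (s2 i k l j) in b1.
have b2 := B j k l i; rewrite (s2 j k l i) (s1 j i k l) in b2.
have b3 := B k l i j; rewrite (s1 k i j l) (s1 k j l i) (s2 j k l i) opprK in b3.
have b4 := B l i j k.
rewrite (s1 l i j k) (s1 l j k i) (s2 j l k i) opprK (s1 l k i j) in b4.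
move: b1 b2 b3 b4.
move: (Q i j k l) (Q k l i j) (Q i k j l) (Q i l j k) (Q j k i l) (Q j l i k).
by move=> *; lra.
Qed.

End CurvatureAlgebra.

Section Curvature.
Variables (R : realType) (n : nat) (U : set 'rV[R]_n).
Variables (G : 'rV[R]_n -> 'M[R]_n).
Hypotheses (Uo : open U) (G_smooth : forall i j, smooth_on U (fun x => G x i j))
  (G_sym : forall x, U x -> (G x)^T = G x)
  (G_unit : forall x, U x -> G x \in unitmx).

Definition curvature_mx (k l : 'I_n) x : 'M[R]_n :=
  \matrix_(i, j) riemann G i j k l x.

Let P (k l : 'I_n) x : 'M[R]_n := \matrix_(i, j) partial k (christoffel G i j l) x.

(** The curvature as the commutator of the covariant derivatives d_k + Gamma_k and d_l + Gamma_l. *)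
Lemma curvature_mxE k l x : curvature_mx k l x =
  P k l x - P l k x + christoffel_mx G k x *m christoffel_mx G l x
    - christoffel_mx G l x *m christoffel_mx G k x.
Proof.
apply/matrixP => i j; rewrite !mxE /riemann; congr (_ + _ - _).
  by apply: eq_bigr => a _; rewrite !mxE mulrC.
by apply: eq_bigr => a _; rewrite !mxE mulrC.
Qed.

Lemma is_dmx_christoffel k l x : U x ->
  is_dmx x (delta_mx 0 k) (christoffel_mx G l) (P k l x).
Proof.
move=> Ux i j; rewrite mxE.
have -> : (fun y => christoffel_mx G l y i j) = christoffel G i j l.
  by apply/funext => y; rewrite mxE.
apply: Ck_derivable Ux; exact: (Ck_christoffel Uo G_smooth G_unit 1).
Qed.

Section Integrability.
Variables (A : 'rV[R]_n -> 'M[R]_n) (mu : 'I_n -> 'rV[R]_n -> R).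
Hypotheses (A_C2 : forall i j, Ck 2 U (fun x => A x i j))
  (mu_C1 : forall i, Ck 1 U (mu i)).

Let u y : 'cV[R]_n := \col_i mu i y.

Hypothesis A_derive : forall k y, U y -> is_dmx y (delta_mx 0 k) A
  ((christoffel_mx G k y)^T *m A y + A y *m christoffel_mx G k y +
   (u y *m row k (G y) + (u y *m row k (G y))^T)).

(* The Ricci identity for [A], in which [A_derive] is substituted. *)
Lemma integrability k l x : U x ->
  let N := col l (\matrix_(i, j) cov1 G mu i j x) *m row k (G x)
         - col k (\matrix_(i, j) cov1 G mu i j x) *m row l (G x) in
  A x *m curvature_mx k l x + (curvature_mx k l x)^T *m A x = N + N^T.
Proof.
move=> Ux N.
pose D a y := (christoffel_mx G a y)^T *m A y + A y *m christoffel_mx G a y +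
   (u y *m row a (G y) + (u y *m row a (G y))^T).
pose du a : 'cV[R]_n := \col_i partial a (mu i) x.
have hu a : is_dmx x (delta_mx 0 a) u (du a).
  move=> i j; rewrite mxE.
  have -> : (fun y => u y i j) = mu i by apply/funext => y; rewrite mxE.
  exact: (Ck_derivable _ (mu_C1 i) Ux).
(* Its entries are Gamma^a_kl g_aj, symmetric in k and l, so the same [s] occurs in both mixed
   derivatives and cancels. *)
pose s : 'rV[R]_n := row k ((christoffel_mx G l x)^T *m G x).
have sE : s = row l ((christoffel_mx G k x)^T *m G x).
  apply/rowP => j; rewrite !mxE; apply: eq_bigr => a _; rewrite !mxE.
  by rewrite (christoffelC a k l Uo Ux G_sym).
pose M a b := du a *m row b (G x) + u x *m
  row b ((christoffel_mx G a x)^T *m G x + G x *m christoffel_mx G a x).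
have hM a b : is_dmx x (delta_mx 0 a) (fun y => u y *m row b (G y)) (M a b).
  by apply: is_dmx_mul => //; apply: is_dmx_row; exact: (is_dmx_metric Uo G_smooth G_sym G_unit).
have hD a b : is_dmx x (delta_mx 0 a) (D b)
   ((P a b x)^T *m A x + (christoffel_mx G b x)^T *m D a x
    + (D a x *m christoffel_mx G b x + A x *m P a b x) + (M a b + (M a b)^T)).
  apply: is_dmx_add.
    apply: is_dmx_add; apply: is_dmx_mul.
    - exact: is_dmx_tr (is_dmx_christoffel a b Ux).
    - exact: A_derive.
    - exact: A_derive.
    - exact: is_dmx_christoffel.
  by apply: is_dmx_add; [exact: hM|exact: is_dmx_tr (hM a b)].
have pA a y i j : U y -> partial a (fun z => A z i j) y = D a y i j.
  by move=> Uy; exact: is_derive_partial (A_derive a Uy i j).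
have pD a b i j : partial a (partial b (fun z => A z i j)) x =
    partial a (fun y => D b y i j) x.
  by apply: (partial_eq Uo) => // y Uy; exact: pA.
have E := @integrability_algebra R n (A x) (christoffel_mx G k x) (christoffel_mx G l x)
  (P k l x) (P l k x) (u x) (du k) (du l) (row k (G x)) (row l (G x)) s.
have Ml : M l k = du l *m row k (G x) + u x *m (s + row k (G x) *m christoffel_mx G l x).
  by rewrite /M /s row_add -row_mul.
have Mk : M k l = du k *m row l (G x) + u x *m (s + row l (G x) *m christoffel_mx G k x).
  by rewrite /M sE row_add -row_mul.
rewrite curvature_mxE /N.
have cE a : col a (\matrix_(i, j) cov1 G mu i j x) = du a - (christoffel_mx G a x)^T *m u x.
  apply/colP => i; rewrite !mxE /cov1; congr (_ - _); apply: eq_bigr => b _.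
  by rewrite !mxE.
rewrite !cE; apply: E; rewrite -Ml -Mk.
apply/matrixP => i j.
rewrite -(is_derive_partial (hD l k i j)) -(is_derive_partial (hD k l i j)) -!pD.
exact: (schwarz l k Uo Ux (A_C2 i j)).
Qed.

End Integrability.

(** The metric is parallel, so it solves the equation of [integrability] with zero covector, and the
    right side vanishes. *)
Lemma curvature_skew k l x : U x ->
  G x *m curvature_mx k l x + (curvature_mx k l x)^T *m G x = 0.
Proof.
move=> Ux.
have H := @integrability G (fun _ _ => 0) (fun i j => G_smooth i j 2) (fun i => Ck_cst Uo 1 0).
rewrite H//.
  have -> : (\matrix_(i, j) cov1 G (fun _ _ => 0) i j x) = 0 :> 'M[R]_n.
    apply/matrixP => i j; rewrite !mxE /cov1 big1 => [|a _]; last by rewrite mulr0.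
    by rewrite subr0; apply: is_derive_partial; exact: is_derive_const.
  by rewrite !col0 !mul0mx subrr trmx0 addr0.
move=> a y Uy.
have -> : (\col_i (0 : R)) = 0 :> 'cV[R]_n by apply/colP => i; rewrite !mxE.
rewrite mul0mx trmx0 !addr0.
exact: (is_dmx_metric Uo G_smooth G_sym G_unit).
Qed.

Lemma riemann_lowE i j k l x : riemann_low G i j k l x = (G x *m curvature_mx k l x) i j.
Proof. by rewrite mxE; apply: eq_bigr => a _; rewrite mxE. Qed.

Lemma riemann_low_skew12 i j k l x : U x ->
  riemann_low G i j k l x = - riemann_low G j i k l x.
Proof.
move=> Ux; rewrite !riemann_lowE; have := curvature_skew k l Ux.
have -> : (curvature_mx k l x)^T *m G x = (G x *m curvature_mx k l x)^T.
  by rewrite trmx_mul G_sym.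
move=> /matrixP/(_ i j); rewrite addmxE [_^T i j]mxE [RHS]mxE => /eqP.
by rewrite addr_eq0 => /eqP.
Qed.

Lemma riemann_skew i j k l x : riemann G i j k l x = - riemann G i j l k x.
Proof.
have alg (a b c d : R) : a - b + c - d = - (b - a + d - c) by ring.
exact: alg.
Qed.

Lemma riemann_low_skew34 i j k l x :
  riemann_low G i j k l x = - riemann_low G i j l k x.
Proof.
rewrite /riemann_low -sumrN; apply: eq_bigr => a _.
by rewrite -mulrN -riemann_skew.
Qed.

(** By the symmetry of the Christoffel symbols in their lower indices, derivative terms and
    quadratic terms each cancel in the cyclic sum. *)
Lemma riemann_low_bianchi i j k l x : U x ->
  riemann_low G i j k l x + riemann_low G i k l j x + riemann_low G i l j k x = 0.
Proof.
move=> Ux; rewrite /riemann_low -!big_split/= big1// => a _; rewrite -!mulrDr.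
have C b c d : christoffel G b c d x = christoffel G b d c x.
  exact: (christoffelC _ _ _ Uo Ux G_sym).
have pC d b c e : partial d (christoffel G b c e) x = partial d (christoffel G b e c) x.
  apply: (partial_eq Uo) => // y Uy; exact: (christoffelC _ _ _ Uo Uy G_sym).
rewrite /riemann (pC k a j l) (pC l a k j) (pC j a l k).
have S b c d : \sum_e christoffel G e b c x * christoffel G a e d x =
    \sum_e christoffel G e c b x * christoffel G a e d x.
  by apply: eq_bigr => e _; rewrite C.
rewrite (S j l k) (S k j l) (S l k j).
have alg (p q r u v w : R) :
  p - q + u - v + (q - r + v - w) + (r - p + w - u) = 0 by ring.
by rewrite alg mulr0.
Qed.

Lemma riemann_low_pair i j k l x : U x ->
  riemann_low G i j k l x = riemann_low G k l i j x.
Proof.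
move=> Ux; apply: (@pair_symmetry_algebra _ _ (fun a b c d => riemann_low G a b c d x)).
- by move=> a b c d; exact: riemann_low_skew12.
- by move=> a b c d; exact: riemann_low_skew34.
- by move=> a b c d; exact: riemann_low_bianchi.
Qed.

(** Raising the first index undoes its lowering, and raising the third moves onto [X]: the operator
    is the contraction of the curvature endomorphisms with the bivector X g^-1. *)
Lemma curvature_opE X x : U x -> curvature_op G x X =
  \sum_q \sum_l (X *m invmx (G x)) l q *: curvature_mx q l x.
Proof.
move=> Ux; apply/matrixP => i j; rewrite mxE summxE.
under [RHS]eq_bigr do rewrite summxE.
have coefE k l : riemann_op_coef G i j k l x =
    \sum_q invmx (G x) k q * riemann G i j q l x.
  rewrite /riemann_op_coef exchange_big/=; apply: eq_bigr => q _.
  under eq_bigr do rewrite mulrAC mulrC riemann_lowE.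
  rewrite -mulr_sumr; congr (_ * _).
  transitivity ((invmx (G x) *m (G x *m curvature_mx q l x)) i j).
    by rewrite mxE.
  by rewrite mulmxA mulVmx ?G_unit// mul1mx mxE.
transitivity (\sum_k \sum_q \sum_l invmx (G x) k q * riemann G i j q l x * X l k).
  apply: eq_bigr => k _; rewrite exchange_big/=; apply: eq_bigr => l _.
  by rewrite coefE mulr_suml.
rewrite exchange_big/=; apply: eq_bigr => q _.
rewrite exchange_big/=; apply: eq_bigr => l _.
rewrite !mxE mulr_suml; apply: eq_bigr => k _.
by rewrite mulrC mulrA.
Qed.

Lemma curvature_op_linear k X Y x :
  curvature_op G x (k *: X + Y) = k *: curvature_op G x X + curvature_op G x Y.
Proof.
apply/matrixP => i j; rewrite !mxE mulr_sumr -big_split; apply: eq_bigr => a _.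
rewrite mulr_sumr -big_split; apply: eq_bigr => b _.
rewrite !mxE/=; move: (riemann_op_coef _ _ _ _ _ _) (X b a) (Y b a) => *.
by ring.
Qed.

Lemma so_invmetric_skew X x : U x -> X \in so (G x) ->
  (X *m invmx (G x))^T = - (X *m invmx (G x)).
Proof.
move=> Ux /soP hX; rewrite trmx_mul trmx_inv G_sym//.
rewrite -[LHS]mulmx1 -(mulmxV (G_unit Ux)) -!mulmxA [X^T *m _]mulmxA hX mulNmx mulmxN.
by rewrite !mulmxA mulVmx ?G_unit// mul1mx.
Qed.

Lemma sum_row_col (S B C : 'M[R]_n) :
  \sum_q \sum_l S l q *: (col l B *m row q C) = B *m S *m C.
Proof.
apply/matrixP => i j; rewrite summxE mxE; apply: eq_bigr => q _.
rewrite summxE mxE mulr_suml; apply: eq_bigr => l _.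
by rewrite !mxE big_ord1 !mxE; ring.
Qed.

(** Stated for arbitrary [A] and [B] because it is applied both to the metric with [B = 0], giving
    that the curvature preserves so(g), and to the form a with the Hessian of lambda. *)
Lemma curvature_op_contract A B X x : U x -> X \in so (G x) ->
  (forall k l, let N := col l B *m row k (G x) - col k B *m row l (G x) in
    A *m curvature_mx k l x + (curvature_mx k l x)^T *m A = N + N^T) ->
  A *m curvature_op G x X + (curvature_op G x X)^T *m A =
  2 *: (B *m X + (B *m X)^T).
Proof.
move=> Ux hX H; rewrite curvature_opE//; set S := X *m _.
have S_skew : S^T = - S by exact: so_invmetric_skew.
have SE l q : S q l = - S l q by move/matrixP: S_skew => /(_ l q); rewrite !mxE.
have SG : S *m G x = X by rewrite -mulmxA mulVmx ?G_unit// mulmx1.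
transitivity (\sum_q \sum_l S l q *: (A *m curvature_mx q l x + (curvature_mx q l x)^T *m A)).
  rewrite mulmx_sumr [_^T]linear_sum mulmx_suml -big_split; apply: eq_bigr => q _ /=.
  rewrite mulmx_sumr [_^T]linear_sum mulmx_suml -big_split; apply: eq_bigr => l _ /=.
  by rewrite [_^T]linearZ/= -scalemxAr -scalemxAl scalerDr.
pose N k l := col l B *m row k (G x) - col k B *m row l (G x).
have NS : \sum_q \sum_l S l q *: N q l = 2 *: (B *m X).
  (* The factor 2 appears here: [N] and the bivector [S] are both skew in the pair of indices, so
     the two halves of [N] contribute equally. *)
  transitivity (\sum_q \sum_l S l q *: (col l B *m row q (G x)) +
      \sum_q \sum_l S l q *: (col l B *m row q (G x))).
    rewrite [X in _ = _ + X]exchange_big/= -big_split; apply: eq_bigr => q _ /=.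
    rewrite -big_split; apply: eq_bigr => l _ /=.
    by rewrite /N scalerBr (SE l q) scaleNr.
  by rewrite sum_row_col -mulmxA SG -mulr2n scaler_nat.
transitivity (\sum_q \sum_l S l q *: (N q l + (N q l)^T)).
  by apply: eq_bigr => q _; apply: eq_bigr => l _; rewrite H.
have NT : \sum_q \sum_l S l q *: (N q l)^T = 2 *: (B *m X)^T.
  transitivity ((2 *: (B *m X))^T); last by rewrite [LHS]linearZ.
  rewrite -NS [RHS]linear_sum; apply: eq_bigr => q _ /=.
  by rewrite [RHS]linear_sum; apply: eq_bigr => l _ /=; rewrite [RHS]linearZ.
rewrite scalerDr -NS -NT -big_split; apply: eq_bigr => q _ /=.
by rewrite -big_split; apply: eq_bigr => l _ /=; rewrite scalerDr.
Qed.

Lemma curvature_op_so X x : U x -> X \in so (G x) -> curvature_op G x X \in so (G x).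
Proof.
move=> Ux hX; apply/soP; apply/eqP; rewrite -addr_eq0 addrC.
rewrite (@curvature_op_contract (G x) 0)//.
  by rewrite mul0mx trmx0 addr0 scaler0.
move=> k l /=; rewrite curvature_skew//.
by rewrite !col0 !mul0mx subrr trmx0 addr0.
Qed.

Lemma trace_curvature_op X Y x : U x ->
  \tr (curvature_op G x X *m Y) = \sum_q \sum_l \sum_p \sum_j
    (X *m invmx (G x)) l q * (Y *m invmx (G x)) j p * riemann_low G p j q l x.
Proof.
move=> Ux; rewrite curvature_opE// mulmx_suml linear_sum; apply: eq_bigr => q _ /=.
rewrite mulmx_suml linear_sum; apply: eq_bigr => l _ /=.
rewrite -scalemxAl linearZ/=.
set S := X *m _; set W := Y *m _.
have -> : Y = W *m G x by rewrite -mulmxA mulVmx ?G_unit// mulmx1.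
rewrite mulmxA mxtrace_mulC mulmxA /mxtrace mulr_sumr.
apply: eq_bigr => p _; rewrite [(_ *m W) p p]mxE mulr_sumr; apply: eq_bigr => j _.
rewrite riemann_lowE; move: ((G x *m curvature_mx q l x) p j) (S l q) (W j p) => *.
by ring.
Qed.

Lemma trace_curvature_op_sym X Y x : U x ->
  \tr (curvature_op G x X *m Y) = \tr (X *m curvature_op G x Y).
Proof.
move=> Ux; rewrite [RHS]mxtrace_mulC !trace_curvature_op//.
transitivity (\sum_q \sum_l \sum_p \sum_j
    (Y *m invmx (G x)) j p * (X *m invmx (G x)) l q * riemann_low G q l p j x).
  do 4!(apply: eq_bigr => ? _); rewrite riemann_low_pair//; ring.
under eq_bigr do rewrite exchange_big/=.
rewrite exchange_big/=; apply: eq_bigr => p _.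
under eq_bigr do rewrite exchange_big/=.
rewrite exchange_big/=; apply: eq_bigr => j _ //.
Qed.

End Curvature.

(** * Projectively equivalent connections *)

Lemma scalemxE (R : nzRingType) p q c (A : 'M[R]_(p, q)) i j : (c *: A) i j = c * A i j.
Proof. by rewrite mxE. Qed.

Section ProjectiveAlgebra.
Variables (R : realType) (n : nat) (T : 'I_n -> 'I_n -> 'I_n -> R).
Hypothesis T_sym : forall i j k, T i j k = T i k j.
Hypothesis T_parallel : forall (v : 'rV[R]_n) i l,
  (\sum_j \sum_k T i j k * v 0 j * v 0 k) * v 0 l =
  (\sum_j \sum_k T l j k * v 0 j * v 0 k) * v 0 i.

Let B i (v w : 'rV[R]_n) := \sum_j \sum_k T i j k * v 0 j * w 0 k.

Let BC i v w : B i v w = B i w v.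
Proof.
rewrite /B exchange_big/=; apply: eq_bigr => j _; apply: eq_bigr => k _.
by rewrite T_sym mulrAC.
Qed.

Let BD i v w z : B i (v + w) z = B i v z + B i w z.
Proof.
rewrite /B -big_split; apply: eq_bigr => j _; rewrite -big_split/=.
by apply: eq_bigr => k _; rewrite mxE; ring.
Qed.

Let BN i v z : B i (- v) z = - B i v z.
Proof.
rewrite /B -sumrN; apply: eq_bigr => j _; rewrite -sumrN/=.
by apply: eq_bigr => k _; rewrite mxE; ring.
Qed.

Let BDr i v w z : B i z (v + w) = B i z v + B i z w.
Proof. by rewrite !(BC i z) BD. Qed.

Let BNr i v z : B i z (- v) = - B i z v.
Proof. by rewrite !(BC i z) BN. Qed.

Let B_delta i j k : B i (delta_mx 0 j) (delta_mx 0 k) = T i j k.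
Proof.
rewrite /B (bigD1 j)//= [X in _ + X]big1 ?addr0 => [|a aj]; last first.
  by apply: big1 => b _; rewrite !mxE (negbTE aj) mulr0 mul0r.
rewrite (bigD1 k)//= big1 ?addr0 => [|b bk]; last first.
  by rewrite [X in _ * X]mxE (negbTE bk) mulr0.
by rewrite !mxE !eqxx !mulr1.
Qed.

(** The cubic identity at [v + w] plus that at [v - w] retains the terms even in [w]; subtracting
    twice the identity at [v] leaves those quadratic in [w]. Polarising in [w] yields [polar3]. *)
Let polar2 i l (v w : 'rV[R]_n) : B i w w * v 0 l + 2 * B i v w * w 0 l =
                     B l w w * v 0 i + 2 * B l v w * w 0 i.
Proof.
have h1 : B i (v + w) (v + w) * (v + w) 0 l = B l (v + w) (v + w) * (v + w) 0 i.
  exact: T_parallel.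
have h2 : B i (v - w) (v - w) * (v - w) 0 l = B l (v - w) (v - w) * (v - w) 0 i.
  exact: T_parallel.
have h3 : B i v v * v 0 l = B l v v * v 0 i := T_parallel v i l.
move: h1 h2 h3; rewrite !(BD, BDr, BN, BNr) !mxE (BC i w v) (BC l w v).
move: (B i v v) (B i v w) (B i w w) (B l v v) (B l v w) (B l w w).
move: (v 0 i) (v 0 l) (w 0 i) (w 0 l) => *.
lra.
Qed.

Let polar3 i l (v w z : 'rV[R]_n) :
  B i w z * v 0 l + B i v w * z 0 l + B i v z * w 0 l =
  B l w z * v 0 i + B l v w * z 0 i + B l v z * w 0 i.
Proof.
have := polar2 i l v z; have := polar2 i l v w; have := polar2 i l v (w + z).
rewrite !(BD, BDr) !mxE (BC i z w) (BC l z w).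
move: (B i w w) (B i z z) (B i w z) (B i v w) (B i v z).
move: (B l w w) (B l z z) (B l w z) (B l v w) (B l v z).
move: (v 0 i) (v 0 l) (w 0 i) (w 0 l) (z 0 i) (z 0 l) => *.
lra.
Qed.

(* [polar3] contracted over [l] and the third vector. *)
Lemma projective_tensor i j k : n.+1%:R * T i j k =
  (\sum_a T a a k) * (i == j)%:R + (\sum_a T a a j) * (i == k)%:R.
Proof.
have d (a b : 'I_n) : (delta_mx 0 a : 'rV[R]_n) 0 b = (b == a)%:R.
  by rewrite mxE eqxx.
have S (f : 'I_n -> R) (a : 'I_n) : \sum_m f m * (m == a)%:R = f a.
  rewrite (bigD1 a)//= eqxx mulr1 big1 ?addr0// => m ma.
  by rewrite (negbTE ma) mulr0.
have P m : T i k m * (m == j)%:R + T i j k * (m == m)%:R + T i j m * (m == k)%:R =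
    T m k m * (i == j)%:R + T m j k * (i == m)%:R + T m j m * (i == k)%:R.
  by have := polar3 i m (delta_mx 0 j) (delta_mx 0 k) (delta_mx 0 m);
    rewrite !B_delta !d.
have : \sum_m (T i k m * (m == j)%:R + T i j k * (m == m)%:R + T i j m * (m == k)%:R) =
    \sum_m (T m k m * (i == j)%:R + T m j k * (i == m)%:R + T m j m * (i == k)%:R).
  by apply: eq_bigr => m _; exact: P.
(* The left side contracts to (n+2) T^i_jk and one copy of T^i_jk returns on the right; hence the
   factor n+1. *)
rewrite !big_split/= !S.
have -> : \sum_(m < n) T i j k * (m == m)%:R = n%:R * T i j k.
  rewrite -mulr_sumr; under eq_bigr do rewrite eqxx.
  by rewrite sumr_const card_ord mulrC.
have -> : \sum_m T m j k * (i == m)%:R = T i j k.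
  by rewrite -[RHS](S (fun m => T m j k)); apply: eq_bigr => m _; rewrite eq_sym.
rewrite -!mulr_suml (T_sym i k j).
have tr b : \sum_a T a b a = \sum_a T a a b by apply: eq_bigr => a _.
rewrite !tr -natr1.
move: (T i j k) (\sum_a T a a k) (\sum_a T a a j) (i == j)%:R (i == k)%:R => *.
lra.
Qed.

End ProjectiveAlgebra.

Section ProjectiveMetrics.
Variables (R : realType) (n : nat) (U : set 'rV[R]_n).
Variables (G H : 'rV[R]_n -> 'M[R]_n).
Hypotheses (Uo : open U)
  (G_smooth : forall i j, smooth_on U (fun x => G x i j))
  (G_sym : forall x, U x -> (G x)^T = G x)
  (G_unit : forall x, U x -> G x \in unitmx)
  (H_smooth : forall i j, smooth_on U (fun x => H x i j))
  (H_sym : forall x, U x -> (H x)^T = H x)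
  (H_unit : forall x, U x -> H x \in unitmx).

Let T i j k x := christoffel H i j k x - christoffel G i j k x.

Hypothesis GH_parallel : forall x, U x -> forall (v : 'rV[R]_n) i l,
  (\sum_j \sum_k T i j k x * v 0 j * v 0 k) * v 0 l =
  (\sum_j \sum_k T l j k x * v 0 j * v 0 k) * v 0 i.

Definition proj_form (k : 'I_n) x : R :=
  n.+1%:R^-1 * (\tr (christoffel_mx H k x) - \tr (christoffel_mx G k x)).

Let phi x : 'rV[R]_n := \row_k proj_form k x.

(** For fixed k, the two terms of T are a scalar matrix and the rank-one matrix whose row k is
    phi. *)
Lemma christoffel_proj k x : U x -> christoffel_mx H k x =
  christoffel_mx G k x + (proj_form k x)%:M + delta_mx k (0 : 'I_1) *m phi x.
Proof.
move=> Ux; apply/matrixP => i j.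
have T_sym a b c : T a b c x = T a c b x.
  by rewrite /T (christoffelC a b c Uo Ux H_sym) (christoffelC a b c Uo Ux G_sym).
have := projective_tensor T_sym (GH_parallel Ux) i j k.
have tr b : \sum_a T a a b x = n.+1%:R * proj_form b x.
  rewrite /proj_form mulrA divff// mul1r -sumrB; apply: eq_bigr => a _.
  by rewrite !mxE.
rewrite !tr => TE.
have E : T i j k x = proj_form k x * (i == j)%:R + proj_form j x * (i == k)%:R.
  by apply: (@mulfI _ n.+1%:R) => //; rewrite TE mulrDr !mulrA.
rewrite !addmxE [(_ *m _) i j]mxE big_ord1.
rewrite [_%:M i j]mxE [delta_mx _ _ i _]mxE [phi x _ _]mxE andbT.
rewrite ![christoffel_mx _ _ _ _ _]mxE -[LHS](subrK (christoffel G i j k x)) -/(T i j k x) E.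
rewrite mulr_natr [proj_form j x * _]mulrC.
by rewrite addrC addrA.
Qed.

Let r : R := n.+1%:R^-1.

Definition scale_factor x : R := `|\det (H x) / \det (G x)| `^ r.

Let f x := \det (H x) / \det (G x).

Let f_neq0 x : U x -> f x != 0.
Proof.
move=> Ux; rewrite mulf_neq0 ?invr_eq0//.
  by have := H_unit Ux; rewrite unitmxE unitfE.
by have := G_unit Ux; rewrite unitmxE unitfE.
Qed.

(** Squaring the quotient removes the absolute value, so smoothness and derivatives need no
    discussion of its sign. *)
Let scale_factorE x : scale_factor x = (f x ^+ 2) `^ (2^-1 * r).
Proof.
rewrite /scale_factor -/(f x) -real_normK ?num_real// -powR_mulrn// -powRrM.
by rewrite mulrA divff// mul1r.
Qed.

Lemma is_derive_scale_factor k x : U x ->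
  is_derive x (delta_mx 0 k) scale_factor (2 * proj_form k x * scale_factor x).
Proof.
move=> Ux.
have dG := is_derive_det_metric Uo G_smooth G_sym G_unit k Ux.
have dH := is_derive_det_metric Uo H_smooth H_sym H_unit k Ux.
have G0 : \det (G x) != 0 by have := G_unit Ux; rewrite unitmxE unitfE.
have df := is_derive_prod dH (@is_derive_inv _ _ (fun y => \det (G y)) x (delta_mx 0 k) _ G0 dG).
have -> : scale_factor = (fun y => (f y * f y) `^ (2^-1 * r)).
  by apply/funext => y; rewrite scale_factorE expr2.
have f2 : 0 < f x * f x by rewrite -expr2 exprn_even_gt0//= f_neq0.
have := @is_derive_outer _ _ (fun z => z `^ (2^-1 * r)) (fun y => f y * f y) x
  (delta_mx 0 k) _ _ (is_derive1_powR (2^-1 * r) f2) (is_derive_prod df df).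
congr is_derive.
have ff : (f x * f x == 0) = false by rewrite gt_eqF.
have -> : (f x * f x) `^ (2^-1 * r - 1) = (f x * f x) `^ (2^-1 * r) / (f x * f x).
  by rewrite powRB ?ff ?implybT// powRr1 ?(ltW f2).
rewrite /proj_form -/r.
have H0 : \det (H x) != 0 by have := H_unit Ux; rewrite unitmxE unitfE.
move: ((f x * f x) `^ (2^-1 * r)) => p; rewrite /f.
move: G0 H0 (\tr (christoffel_mx H k x)) (\tr (christoffel_mx G k x)).
move: (\det (G x)) (\det (H x)) r => a b c a0 b0 t s.
by field; rewrite a0 b0.
Qed.

Let Ck_scale_factor m : Ck m U scale_factor.
Proof.
apply: (Ck_eq Uo (f := fun y => (f y * f y) `^ (2^-1 * r))).
  by move=> y _; rewrite scale_factorE expr2.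
have Cf : Ck m U f.
  apply: CkM => //; first by apply: Ck_det => // i j; exact: H_smooth.
  apply: CkV => //; last by apply: Ck_det => // i j; exact: G_smooth.
  by move=> y /G_unit; rewrite unitmxE unitfE.
apply: Ck_powR => //; last exact: CkM.
by move=> y Uy; rewrite -expr2 exprn_even_gt0//= f_neq0.
Qed.

Lemma Ck_a_form m i j : Ck m U (fun x => a_form G H x i j).
Proof.
apply: (Ck_eq Uo (f := fun x => scale_factor x *
   \sum_a (\sum_b G x i b * invmx (H x) b a) * G x a j)).
  move=> y _; rewrite !mxE; congr (_ * _); apply: eq_bigr => a _.
  by rewrite mxE.
apply: CkM => //; apply: Ck_sum => // a; apply: CkM => //; last exact: G_smooth.
apply: Ck_sum => // b; apply: CkM => //; first exact: G_smooth.
by apply: Ck_invmx => // c d; exact: H_smooth.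
Qed.

Lemma a_form_sym x : U x -> (a_form G H x)^T = a_form G H x.
Proof.
move=> Ux; rewrite /a_form linearZ/= !trmx_mul trmx_inv G_sym// H_sym//.
by rewrite mulmxA.
Qed.

Let u x : 'cV[R]_n := - (scale_factor x *: (G x *m invmx (H x) *m (phi x)^T)).

(** The linear equation for a. Rewriting the connection of [H] in terms of that of [G], the scalar
    part contributes -2 phi_k a, cancelled by the derivative of the scale factor; the rank-one part
    contributes the two terms in [u]. *)
Lemma is_dmx_a_form k x : U x -> is_dmx x (delta_mx 0 k) (a_form G H)
  ((christoffel_mx G k x)^T *m a_form G H x + a_form G H x *m christoffel_mx G k x +
   (u x *m row k (G x) + (u x *m row k (G x))^T)).
Proof.
move=> Ux.
have dG := is_dmx_metric Uo G_smooth G_sym G_unit k Ux.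
have dJ := is_dmx_invmetric Uo H_smooth H_sym H_unit k Ux.
have dS := is_derive_scale_factor k Ux.
have := is_dmx_scale dS (is_dmx_mul (is_dmx_mul dG dJ) dG).
congr is_dmx; rewrite (christoffel_proj k Ux) /a_form -/(scale_factor x) /u.
have rk : row k (G x) = (delta_mx k 0)^T *m G x by rewrite trmx_delta -rowE.
rewrite rk !(trmxD, trmx_mul, trmxN, trmxK, G_sym Ux) tr_scalar_mx.
have JT : (invmx (H x))^T = invmx (H x) by rewrite trmx_inv H_sym.
have trZ p q c (A : 'M[R]_(p, q)) : (c *: A)^T = c *: A^T by rewrite linearZ.
rewrite !(trZ, trmx_mul, trmxK, G_sym Ux, JT).
move: (delta_mx k 0) (christoffel_mx G k x) (invmx (H x)) (phi x) => e K J P.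
move: (proj_form k x) (scale_factor x) (G x) => c s g.
rewrite !(mulmxDl, mulmxDr, mulNmx, mulmxN, opprD).
rewrite !(mul_scalar_mx, mul_mx_scalar) -?scalemxAl -?scalemxAr -?scalemxAl.
rewrite !(mulmxDl, mulmxDr, mulNmx, mulmxN, opprD, mulmxA).
apply/matrixP => i j; rewrite !(addmxE, oppmxE, scalemxE).
by ring.
Qed.

Lemma lam_trace x : U x -> lam G H x = 2^-1 * \tr (a_form G H x *m invmx (G x)).
Proof.
move=> Ux; congr (_ * _); apply: eq_bigr => i _; rewrite mxE.
apply: eq_bigr => j _; congr (_ * _).
by rewrite -[in LHS](G_sym Ux) -trmx_inv mxE.
Qed.

Lemma Ck_lam m : Ck m U (lam G H).
Proof.
apply: CkZ => //; apply: Ck_sum => // i; apply: Ck_sum => // j; apply: CkM => //.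
  exact: Ck_a_form.
by apply: Ck_invmx => // c d; exact: G_smooth.
Qed.

(** Tracing the linear equation with the inverse metric: the connection terms cancel and each of the
    two terms in [u] contributes [u k], which the factor 1/2 in [lam] compensates. *)
Lemma partial_lam k x : U x -> partial k (lam G H) x = u x k 0.
Proof.
move=> Ux.
rewrite (partial_eq Uo (g := fun y => 2^-1 * \tr (a_form G H y *m invmx (G y))))//; last first.
  exact: lam_trace.
have dJ := is_dmx_invmetric Uo G_smooth G_sym G_unit k Ux.
have := is_dmx_trace (is_dmx_mul (is_dmx_a_form k Ux) dJ).
move=> /(is_derive_prod (is_derive_const (2^-1 : R) x (delta_mx 0 k)))/is_derive_partial ->.
rewrite mul0r add0r.
set A := a_form G H x; set K := christoffel_mx G k x; set J := invmx (G x).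
have tM : \tr (u x *m row k (G x) *m J) = u x k 0.
  rewrite [row k _]rowE -!mulmxA mulmxV ?G_unit// mulmx1 mxtrace_mulC.
  by rewrite /mxtrace big_ord1 -rowE mxE.
have tMT : \tr ((u x *m row k (G x))^T *m J) = u x k 0.
  rewrite -tM -[LHS]mxtrace_tr trmx_mul trmxK mxtrace_mulC /J trmx_inv G_sym//.
rewrite mulmxN !mulmxDl mulmxDr !mxtraceD linearN/= !mxtraceD tM tMT.
rewrite [\tr (K^T *m A *m J)]mxtrace_mulC !mulmxA [\tr (J *m K^T *m A)]mxtrace_mulC mulmxA.
by field.
Qed.

Lemma hessian_lam_sym x : U x -> (hessian G (lam G H) x)^T = hessian G (lam G H) x.
Proof.
move=> Ux; apply/matrixP => i j; rewrite !mxE /cov1.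
rewrite (schwarz i j Uo Ux (Ck_lam 2)); congr (_ - _).
by apply: eq_bigr => a _; rewrite (christoffelC a j i Uo Ux G_sym).
Qed.

Lemma a_form_op x : U x -> a_form G H x = G x *m a_op G H x.
Proof. by move=> Ux; rewrite /a_op mulmxA mulmxV ?G_unit// mul1mx. Qed.

Lemma curvature_sectional x : U x ->
  sectional_operator (G x) (curvature_op G x) (a_op G H x) (b_op G H x).
Proof.
move=> Ux; split.
- split; rewrite /Defs.Sym.
    rewrite -(a_form_op Ux) /a_op trmx_mul trmx_inv G_sym// a_form_sym//.
    by rewrite -mulmxA mulVmx ?G_unit// mulmx1.
  rewrite /b_op linearZ/= trmx_mul trmx_inv G_sym// hessian_lam_sym// -scalemxAl.
  rewrite -scalemxAr -mulmxA mulVmx ?G_unit// mulmx1 mulmxA mulmxV ?G_unit//.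
  by rewrite mul1mx.
- by move=> X; exact: (curvature_op_so Uo G_smooth G_sym G_unit Ux).
- by move=> k X Y _ _; exact: curvature_op_linear.
- move=> X Y hX hY.
  rewrite !killing_so ?G_sym ?G_unit ?(curvature_op_so Uo G_smooth G_sym G_unit)//.
  by rewrite (trace_curvature_op_sym Uo G_smooth G_sym G_unit).
move=> X hX.
have hP := curvature_op_so Uo G_smooth G_sym G_unit Ux hX.
pose mu i y := partial i (lam G H) y.
have muE y : U y -> \col_i mu i y = u y.
  by move=> Uy; apply/colP => i; rewrite mxE /mu partial_lam.
have A_derive k y : U y -> is_dmx y (delta_mx 0 k) (a_form G H)
  ((christoffel_mx G k y)^T *m a_form G H y + a_form G H y *m christoffel_mx G k y +
   ((\col_i mu i y) *m row k (G y) + ((\col_i mu i y) *m row k (G y))^T)).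
  by move=> Uy; rewrite muE//; exact: is_dmx_a_form.
have I := integrability Uo G_smooth G_sym G_unit (fun i j => Ck_a_form 2 i j)
  (fun i => Ck_partial i (Ck_lam 2)) A_derive.
have := curvature_op_contract G_sym G_unit Ux hX (fun k l => I k l x Ux).
rewrite -/(hessian G (lam G H) x).
move: hP; set P := curvature_op G x X => /soP hP E.
have PT : invmx (G x) *m P^T *m G x = - P.
  by rewrite -mulmxA hP mulmxN mulmxA mulVmx ?G_unit// mul1mx.
have XT : invmx (G x) *m X^T *m G x = - X.
  by move/soP: hX => hX; rewrite -mulmxA hX mulmxN mulmxA mulVmx ?G_unit// mul1mx.
(* Raising an index turns the transposes of [P] and [X] into their negatives, so the two sides
   become minus the commutators [P, a] and [X, b]. *)
move/(congr1 (fun Z => invmx (G x) *m Z)): E => /=.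
have -> : invmx (G x) *m (a_form G H x *m P + P^T *m a_form G H x) =
    a_op G H x *m P - P *m a_op G H x.
  rewrite mulmxDr {2}(a_form_op Ux) [X in X + _]mulmxA -/(a_op G H x).
  by rewrite [P^T *m _]mulmxA [invmx _ *m (_ *m a_op G H x)]mulmxA
    [invmx _ *m (P^T *m _)]mulmxA PT mulNmx.
rewrite -scalemxAr mulmxDr scalerDr trmx_mul hessian_lam_sym//.
rewrite [X in 2 *: X + _]mulmxA scalemxAl -/(b_op G H x).
have -> : 2 *: (invmx (G x) *m (X^T *m hessian G (lam G H) x)) = - (X *m b_op G H x).
  rewrite /b_op -scalemxAr -scalerN -mulNmx -XT; congr (_ *: _).
  by rewrite -!mulmxA [G x *m (invmx _ *m _)]mulmxA mulmxV ?G_unit// mul1mx.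
by rewrite /lie => E; rewrite -opprB E opprB.
Qed.

End ProjectiveMetrics.

(** * Geodesics *)

Section Curves.
Variable R : realType.
Implicit Types (f F : R -> R) (t : R).

Lemma is_derive_derive1 f t a : is_derive t (1 : R) f a -> derive1 f t = a.
Proof. by move=> [_ <-]; rewrite derive1E. Qed.

Lemma second_derivative f F t b : (\near t, is_derive t (1 : R) f (F t)) ->
  is_derive t (1 : R) F b ->
  [/\ derivable f t 1, derivable (derive1 f) t 1, derive1 f t = F t
    & derive1n 2 f t = b].
Proof.
move=> fF dF.
have dft : is_derive t (1 : R) f (F t) by exact: nbhs_singleton fF.
have d2 : is_derive t (1 : R) (derive1 f) b.
  apply: is_derive_near dF; apply: filterS fF => s ds.
  by rewrite (is_derive_derive1 ds).
split; [by case: dft|by case: d2|exact: is_derive_derive1|].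
exact: (is_derive_derive1 d2).
Qed.

Lemma curve_continuous n (x : R -> 'rV[R]_n) t :
  (forall i, derivable (fun s => x s 0 i) t 1) -> {for t, continuous x}.
Proof.
move=> dx; apply/cvg_ballP => e e0.
have H : \forall s \near t, forall i, `|x t 0 i - x s 0 i| < e.
  apply: (@filter_forall _ _ (fun i s => `|x t 0 i - x s 0 i| < e) (nbhs t)) => i.
  have /derivable1_diffP/differentiable_continuous/cvgrPdist_lt/(_ e e0) := dx i.
  exact.
by apply: filterS H => s Hs; split => // i j; rewrite ord1; exact: Hs.
Qed.

Lemma near_interval (r t : R) : `|t| < r -> \forall s \near t, `|s| < r.
Proof.
move=> tr; have c : (fun s : R => s) @ t --> t by exact: cvg_id.
move/cvgrPdist_lt : c => /(_ (r - `|t|)); rewrite subr_gt0 => /(_ tr).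
apply: filterS => s ts; rewrite -[s](subKr t).
by apply: le_lt_trans (ler_normB _ _) _; rewrite -ltrBrDl.
Qed.

End Curves.

Section LoweredGeodesics.
Variables (R : realType) (n : nat) (U : set 'rV[R]_n).
Variables (G : 'rV[R]_n -> 'M[R]_n).
Hypotheses (Uo : open U) (G_smooth : forall i j, smooth_on U (fun x => G x i j))
  (G_sym : forall x, U x -> (G x)^T = G x)
  (G_unit : forall x, U x -> G x \in unitmx).

Definition dir_metric x (v : 'cV[R]_n) : 'M[R]_n :=
  \matrix_(i, j) \sum_m partial m (fun y => G y i j) x * v m 0.

(** The gradient in the position of the quadratic form g(v,v) with [v] frozen, that is, twice the
    force term of the Euler-Lagrange equation. *)
Definition partial_quad x (v : 'cV[R]_n) : 'cV[R]_n :=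
  \col_i \sum_j \sum_k partial i (fun y => G y j k) x * v j 0 * v k 0.

Definition acceleration x (v a : 'cV[R]_n) : 'cV[R]_n :=
  \col_i (a i 0 + \sum_j \sum_k christoffel G i j k x * v j 0 * v k 0).

(* Along a curve with velocity [v], [G a + G' v] is the derivative of [G v]: the
   geodesic equation is the Euler-Lagrange equation of the energy. *)
Lemma lower_acceleration x v a : U x ->
  G x *m acceleration x v a =
  G x *m a + dir_metric x v *m v - 2^-1 *: partial_quad x v.
Proof.
move=> Ux; apply/colP => i; rewrite !mxE.
under eq_bigr do rewrite mxE mulrDr.
rewrite big_split/= -addrA; congr (_ + _).
transitivity (\sum_j \sum_k (2^-1 * (partial j (fun y => G y i k) x +
   partial k (fun y => G y i j) x - partial i (fun y => G y j k) x)) * v j 0 * v k 0).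
  under eq_bigr do rewrite mulr_sumr.
  rewrite exchange_big/=; apply: eq_bigr => j _.
  under eq_bigr do rewrite mulr_sumr.
  rewrite exchange_big/=; apply: eq_bigr => k _.
  rewrite -(christoffel_low G_unit i j k Ux) !mulr_suml.
  by apply: eq_bigr => m _; rewrite !mulrA.
have E1 : \sum_j dir_metric x v i j * v j 0 =
    \sum_j \sum_k partial j (fun y => G y i k) x * v j 0 * v k 0.
  rewrite exchange_big/=; apply: eq_bigr => j _; rewrite mxE mulr_suml.
  by apply: eq_bigr => k _.
have E2 : \sum_j dir_metric x v i j * v j 0 =
    \sum_j \sum_k partial k (fun y => G y i j) x * v j 0 * v k 0.
  apply: eq_bigr => j _; rewrite mxE mulr_suml.
  by apply: eq_bigr => k _; rewrite mulrAC.
have -> : \sum_j dir_metric x v i j * v j 0 = 2^-1 * (\sum_j dir_metric x v i j * v j 0)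
   + 2^-1 * (\sum_j dir_metric x v i j * v j 0).
  by rewrite -mulrDl (_ : 2^-1 + 2^-1 = 1 :> R) ?mul1r//; field.
rewrite {1}E1 E2 !mulr_sumr -big_split -sumrB/=; apply: eq_bigr => j _.
rewrite !mulr_sumr -big_split -sumrB/=; apply: eq_bigr => k _.
move: (partial j _ _) (partial k _ _) (partial i _ _) (v j 0) (v k 0) => *.
by ring.
Qed.

Lemma acceleration_eq0 x v a : U x ->
  (acceleration x v a == 0) =
  (G x *m a + dir_metric x v *m v - 2^-1 *: partial_quad x v == 0).
Proof.
move=> Ux; rewrite -lower_acceleration//; apply/eqP/eqP => [->|]; first by rewrite mulmx0.
by move=> /(congr1 (fun Z => invmx (G x) *m Z)); rewrite mulmxA mulVmx ?G_unit// mul1mx mulmx0.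
Qed.

Lemma is_dmx_metric_curve (x : R -> 'rV[R]_n) (v : 'cV[R]_n) t : U (x t) ->
  (forall i, is_derive t (1 : R) (fun s => x s 0 i) (v i 0)) ->
  is_dmx t (1 : R) (fun s => G (x s)) (dir_metric (x t) v).
Proof.
move=> Ux dx i j; rewrite mxE.
exact: (chain_rule Uo (G_smooth i j 1) Ux dx).
Qed.

End LoweredGeodesics.

(** * Covariance of the geodesic equation *)

Section ChangeOfCoordinates.
Variables (R : realType) (n : nat) (U W : set 'rV[R]_n).
Variables (G D : 'rV[R]_n -> 'M[R]_n) (tau : 'rV[R]_n -> 'rV[R]_n).
Hypotheses (Uo : open U) (Wo : open W)
  (G_smooth : forall i j, smooth_on U (fun x => G x i j))
  (G_sym : forall x, U x -> (G x)^T = G x)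
  (G_unit : forall x, U x -> G x \in unitmx)
  (D_smooth : forall i j, smooth_on W (fun x => D x i j))
  (D_sym : forall x, W x -> (D x)^T = D x)
  (D_unit : forall x, W x -> D x \in unitmx)
  (tau_smooth : forall i, smooth_on U (fun x => tau x 0 i))
  (tau_W : forall x, U x -> W (tau x)).

(** Rows are indexed by source coordinates, the transpose of the usual convention: covectors are
    pulled back by this matrix, velocities are pushed forward by its transpose. *)
Definition coord_jacobian x : 'M[R]_n := \matrix_(i, k) partial i (fun y => tau y 0 k) x.

Hypothesis GD : forall x, U x -> G x = coord_jacobian x *m D (tau x) *m (coord_jacobian x)^T.

Definition dir_jacobian x (v : 'cV[R]_n) : 'M[R]_n :=
  \matrix_(i, k) \sum_m partial m (partial i (fun y => tau y 0 k)) x * v m 0.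

Lemma jacobian_unit x : U x -> coord_jacobian x \in unitmx.
Proof.
move=> Ux; have := G_unit Ux; rewrite GD// !unitmxE !det_mulmx det_tr !unitrM.
by move=> /andP[/andP[]].
Qed.

Variables (x v : R -> 'rV[R]_n) (a : 'cV[R]_n) (t : R).
Hypotheses (Ux : U (x t))
  (dx : \forall s \near t, forall i, is_derive s (1 : R) (fun s => x s 0 i) (v s 0 i))
  (dv : forall i, is_derive t (1 : R) (fun s => v s 0 i) (a i 0)).

Let vc s : 'cV[R]_n := (v s)^T.
Let wc s : 'cV[R]_n := (coord_jacobian (x s))^T *m vc s.
Let b : 'cV[R]_n := (dir_jacobian (x t) (vc t))^T *m vc t + (coord_jacobian (x t))^T *m a.

Let nU : \forall s \near t, U (x s).
Proof.
have cx : {for t, continuous x}.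
  by apply: curve_continuous => i; have [] := nbhs_singleton dx i.
by apply: cx; exact: open_nbhs_nbhs.
Qed.

Let dx_t i : is_derive t (1 : R) (fun s => x s 0 i) (vc t i 0).
Proof. by rewrite mxE; exact: nbhs_singleton dx i. Qed.

Let dvc : is_dmx t (1 : R) vc a.
Proof.
move=> i j; rewrite ord1.
by have -> : (fun s => vc s i 0) = (fun s => v s 0 i) by apply/funext => s; rewrite mxE.
Qed.

Let dJ : is_dmx t (1 : R) (fun s => coord_jacobian (x s)) (dir_jacobian (x t) (vc t)).
Proof.
move=> i k; rewrite mxE.
have -> : (fun s => coord_jacobian (x s) i k) = (fun s => partial i (fun y => tau y 0 k) (x s)).
  by apply/funext => s; rewrite mxE.
apply: (chain_rule Uo (Ck_partial i (tau_smooth k 2)) Ux).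
exact: dx_t.
Qed.

Let dwc : is_dmx t (1 : R) wc b.
Proof. by apply: is_dmx_mul => //; exact: is_dmx_tr. Qed.

Lemma transported_velocity : \forall s \near t, forall i,
  is_derive s (1 : R) (fun s => tau (x s) 0 i) (wc s i 0).
Proof.
near=> s => i.
have Uxs : U (x s) by near: s.
have dxs : forall i, is_derive s (1 : R) (fun s => x s 0 i) (v s 0 i) by near: s.
have := chain_rule Uo (tau_smooth i 1) Uxs dxs.
congr is_derive; rewrite mxE; apply: eq_bigr => k _; by rewrite !mxE.
Unshelve. all: by end_near. Qed.

Lemma transported_acceleration i : is_derive t (1 : R) (fun s => wc s i 0) (b i 0).
Proof. exact: dwc. Qed.

(** The momentum satisfies G v = J (D w) along the curve; the two sides are the derivatives of these
    two expressions. *)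
Let dG : dir_metric G (x t) (vc t) *m vc t + G (x t) *m a =
  dir_jacobian (x t) (vc t) *m (D (tau (x t)) *m wc t) +
  coord_jacobian (x t) *m (dir_metric D (tau (x t)) (wc t) *m wc t + D (tau (x t)) *m b).
Proof.
have h1 := is_dmx_mul (is_dmx_metric_curve Uo G_smooth Ux dx_t) dvc.
have hD := @is_dmx_metric_curve R n W D Wo D_smooth (fun s => tau (x s)) (wc t) t
  (tau_W Ux) (nbhs_singleton transported_velocity).
have h2 := is_dmx_mul dJ (is_dmx_mul hD dwc).
apply: is_dmx_unique h1 _; apply: is_dmx_near h2.
by apply: filterS nU => s Us; rewrite (GD Us) /wc !mulmxA.
Qed.

(** The gradient of V^T J D J^T V with [V] frozen. The factor J occurs twice, whence the 2, and
    symmetry of the second derivatives of [tau] turns its gradient into the derivative of J along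
    [V]. *)
Let quad_partial : partial_quad G (x t) (vc t) =
  2 *: (dir_jacobian (x t) (vc t) *m (D (tau (x t)) *m wc t)) +
  coord_jacobian (x t) *m partial_quad D (tau (x t)) (wc t).
Proof.
set y := x t; set z := tau y; set V := vc t; set w := wc t.
apply/colP => i.
pose e := delta_mx 0 i : 'rV[R]_n.
pose Ji := \matrix_(j, k) partial i (partial j (fun y => tau y 0 k)) y : 'M[R]_n.
pose Di := \matrix_(k, l) \sum_m partial m (fun q => D q k l) z * coord_jacobian y i m : 'M[R]_n.
have hJ : is_dmx y e coord_jacobian Ji.
  move=> j k; rewrite mxE.
  have -> : (fun y => coord_jacobian y j k) = partial j (fun y => tau y 0 k).
    by apply/funext => q; rewrite mxE.
  exact: (Ck_derivable i (Ck_partial j (tau_smooth k 2)) Ux).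
have hD : is_dmx y e (fun q => D (tau q)) Di.
  move=> k l; rewrite mxE; apply: (chain_rule Wo (D_smooth k l 1) (tau_W Ux)) => m.
  by rewrite mxE; exact: (Ck_derivable i (tau_smooth m 1) Ux).
have hG : is_dmx y e G (\matrix_(j, k) partial i (fun q => G q j k) y).
  by move=> j k; rewrite mxE; exact: (Ck_derivable i (G_smooth j k 1) Ux).
have hG' : is_dmx y e G ((Ji *m D z + coord_jacobian y *m Di) *m (coord_jacobian y)^T +
    coord_jacobian y *m D z *m Ji^T).
  have := is_dmx_mul (is_dmx_mul hJ hD) (is_dmx_tr hJ).
  apply: is_dmx_near; apply: filterS (open_nbhs_nbhs (conj Uo Ux)) => q Uq.
  by rewrite GD.
have quadE (A : 'M[R]_n) (u : 'cV[R]_n) :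
    (u^T *m A *m u) 0 0 = \sum_j \sum_k A j k * u j 0 * u k 0.
  rewrite mxE exchange_big/=; apply: eq_bigr => k _; rewrite mxE mulr_suml.
  by apply: eq_bigr => j _; rewrite mxE; congr (_ * _); rewrite mulrC.
have -> : partial_quad G y V i 0 =
    (V^T *m (\matrix_(j, k) partial i (fun q => G q j k) y) *m V) 0 0.
  rewrite quadE mxE; apply: eq_bigr => j _; apply: eq_bigr => k _.
  by rewrite [in RHS]mxE.
rewrite (is_dmx_unique hG hG').
have wE : w = (coord_jacobian y)^T *m V by [].
have -> : V^T *m ((Ji *m D z + coord_jacobian y *m Di) *m (coord_jacobian y)^T +
    coord_jacobian y *m D z *m Ji^T) *m V =
    (V^T *m Ji) *m (D z *m w) + w^T *m Di *m w + ((V^T *m Ji) *m (D z *m w))^T.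
  rewrite wE !(trmx_mul, trmxK) (D_sym (tau_W Ux)).
  by rewrite !(mulmxDl, mulmxDr) !mulmxA.
have JV : V^T *m Ji = row i (dir_jacobian y V).
  apply/rowP => k; rewrite !mxE; apply: eq_bigr => m _; rewrite !mxE mulrC.
  by rewrite (schwarz i m Uo Ux (tau_smooth k 2)).
have DiE : (w^T *m Di *m w) 0 0 = (coord_jacobian y *m partial_quad D z w) i 0.
  rewrite quadE mxE.
  under [RHS]eq_bigr do rewrite [partial_quad _ _ _ _ _]mxE mulr_sumr.
  rewrite [RHS]exchange_big/=; apply: eq_bigr => j _.
  under [RHS]eq_bigr do rewrite mulr_sumr.
  rewrite [RHS]exchange_big/=; apply: eq_bigr => k _.
  rewrite [Di _ _]mxE !mulr_suml; apply: eq_bigr => m _.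
  by rewrite [partial _ _ _ * coord_jacobian _ _ _]mulrC -!mulrA.
rewrite !addmxE scalemxE DiE [(_^T) 0 0]mxE JV.
have -> : (row i (dir_jacobian y V) *m (D z *m w)) 0 0 = (dir_jacobian y V *m (D z *m w)) i 0.
  by rewrite -row_mul mxE.
move: ((dir_jacobian y V *m (D z *m w)) i 0) ((coord_jacobian y *m _) i 0) => p q.
by ring.
Qed.

(** In momentum derivative minus half the gradient, the terms with the derivative of J cancel. What
    remains is J times the same expression in the new coordinates, and J is invertible. *)
Lemma geodesic_transport :
  acceleration G (x t) (vc t) a = 0 -> acceleration D (tau (x t)) (wc t) b = 0.
Proof.
move=> /eqP; rewrite (acceleration_eq0 G_unit)// => /eqP E; apply/eqP.
rewrite (acceleration_eq0 D_unit); last exact: tau_W.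
apply/eqP.
have : coord_jacobian (x t) *m (D (tau (x t)) *m b + dir_metric D (tau (x t)) (wc t) *m wc t -
    2^-1 *: partial_quad D (tau (x t)) (wc t)) = 0.
  rewrite -[RHS]E [G _ *m a + _]addrC dG quad_partial scalerDr scalerA mulVf// scale1r.
  rewrite mulmxDr mulmxN -scalemxAr [D _ *m b + _]addrC opprD.
  by rewrite addrACA subrr add0r.
move=> /(congr1 (fun Z => invmx (coord_jacobian (x t)) *m Z)).
by rewrite mulmxA mulVmx ?jacobian_unit// mul1mx mulmx0.
Qed.

Lemma geodesic_equation_transport : acceleration G (x t) (vc t) a = 0 ->
  let y i s := tau (x s) 0 i in
  forall i, [/\ derivable (y i) t 1, derivable (derive1 (y i)) t 1
    & derive1n 2 (y i) t + \sum_j \sum_k christoffel D i j k (tau (x t)) *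
        derive1 (y j) t * derive1 (y k) t = 0].
Proof.
move=> E y i.
have sd j : [/\ derivable (y j) t 1, derivable (derive1 (y j)) t 1,
    derive1 (y j) t = wc t j 0 & derive1n 2 (y j) t = b j 0].
  apply: (@second_derivative _ _ (fun s => wc s j 0)); last exact: transported_acceleration.
  by apply: filterS transported_velocity => s; exact.
have [d1 d2 _ ->] := sd i; split => //.
have /colP/(_ i) := geodesic_transport E; rewrite [LHS]mxE [RHS]mxE => H; rewrite -[RHS]H.
congr (_ + _); apply: eq_bigr => j _; apply: eq_bigr => k _.
by have [_ _ -> _] := sd j; have [_ _ -> _] := sd k.
Qed.

End ChangeOfCoordinates.

Lemma Ck_subset (R : realType) n k (U W : set 'rV[R]_n) (f : 'rV[R]_n -> R) :
  W `<=` U -> Ck k U f -> Ck k W f.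
Proof.
move=> WU; elim: k f => [|k IH] f [cf df]; (split; first by move=> x /WU; exact: cf) => // i.
by have [d C] := df i; split => [x /WU|]; [exact: d|exact: IH].
Qed.

(** * Geodesics on the manifold and geodesic equivalence *)

Section Geodesics.
Variables (R : realType) (n : nat) (M : manifold R n).
Implicit Types (g h : metric M) (c d : chart_index M).

Lemma overlap_open c d : open (overlap (atlas c) (atlas d)).
Proof.
rewrite openE => x [cx dx].
have n1 : nbhs x (ccod (atlas c)).
  by apply: open_nbhs_nbhs; split => //; exact: ccod_open.
have n2 : nbhs x (fun y => cdom (atlas d) (cinv (atlas c) y)).
  apply: (cinv_continuous cx); apply: open_nbhs_nbhs; split => //.
  exact: cdom_open.
exact: filterI n1 n2.
Qed.

Lemma metric_change_mx g c d x : overlap (atlas c) (atlas d) x ->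
  let tau := transition (atlas c) (atlas d) in
  g c x = coord_jacobian tau x *m g d (tau x) *m (coord_jacobian tau x)^T.
Proof.
move=> Wx tau; apply/matrixP => i j; rewrite (gcomp_transition g Wx) mxE exchange_big/=.
apply: eq_bigr => l _; rewrite mxE mulr_suml; apply: eq_bigr => k _.
by rewrite !mxE mulrAC.
Qed.

(** Besides being a geodesic in every chart, by transport on overlaps, the curve is returned with
    its equation in chart [c], from which T is computed. *)
Lemma geodesic_exists g c (x0 v0 : 'rV[R]_n) : ccod (atlas c) x0 ->
  exists2 r : R, 0 < r & exists x v : R -> 'rV[R]_n,
    [/\ x 0 = x0, v 0 = v0,
        forall t, `|t| < r ->
          [/\ ccod (atlas c) (x t),
              forall i, is_derive t (1 : R) (fun s => x s 0 i) (v t 0 i)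
            & forall i, is_derive t (1 : R) (fun s => v s 0 i)
                (- \sum_j \sum_k christoffel (g c) i j k (x t) * v t 0 j * v t 0 k)]
      & geodesic g [set t | `|t| < r] (cinv (atlas c) \o x)].
Proof.
move=> Ux0.
have C1 i j k : Ck 1 (ccod (atlas c)) (christoffel (g c) i j k).
  exact: (Ck_christoffel (@ccod_open _ _ _ (atlas c)) (@gcomp_smooth _ _ _ g c)
    (@gcomp_nondegenerate _ _ _ g c) 1 i j k).
have [r r0 [x [v [x00 v00 xv]]]] := geodesic_ode (@ccod_open _ _ _ (atlas c)) C1 v0 Ux0.
exists r => //; exists x, v; split => // t /= tr; have [Uxt dx dv] := xv t tr.
split.
  have cx : {for t, continuous x} by apply: curve_continuous => i; have [] := dx i.
  exact: (continuous_comp cx (cinv_continuous Uxt)).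
move=> d dd.
pose W := overlap (atlas c) (atlas d).
have WU : W `<=` ccod (atlas c) by move=> y [].
pose tau := transition (atlas c) (atlas d).
pose a : 'cV[R]_n := \col_i (- \sum_j \sum_k christoffel (g c) i j k (x t) * v t 0 j * v t 0 k).
have ndx : \forall s \near t, forall i, is_derive s (1 : R) (fun s => x s 0 i) (v s 0 i).
  by apply: filterS (near_interval tr) => s sr; have [] := xv s sr.
have dva i : is_derive t (1 : R) (fun s => v s 0 i) (a i 0) by rewrite mxE.
have a0 : acceleration (g c) (x t) (v t)^T a = 0.
  apply/colP => i; rewrite !mxE addrC; apply/eqP; rewrite subr_eq0; apply/eqP.
  by apply: eq_bigr => j _; apply: eq_bigr => k _; rewrite !mxE.
have gW_smooth i j : smooth_on W (fun y => g c y i j).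
  by move=> m; apply: Ck_subset WU _; exact: gcomp_smooth.
have gW_unit y : W y -> g c y \in unitmx by move=> /WU; exact: gcomp_nondegenerate.
have tau_cod y : W y -> ccod (atlas d) (tau y) by move=> [_ dy]; exact: cmap_cod.
have Wxt : W (x t) by split.
have E := @geodesic_equation_transport R n W (ccod (atlas d)) (g c) (g d) tau
  (@overlap_open c d) (@ccod_open _ _ _ (atlas d)) gW_smooth gW_unit
  (@gcomp_smooth _ _ _ g d) (@gcomp_sym _ _ _ g d) (@gcomp_nondegenerate _ _ _ g d)
  (@atlas_smooth _ _ M c d) tau_cod (@metric_change_mx g c d)
  x v a t Wxt ndx dva a0.
by move=> i; have [e1 e2 e3] := E i; split; [exact: e1|exact: e2|exact: e3].
Qed.

Lemma geodesic_unparametrized g (I : set R) (gam : R -> M) :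
  open_interval I -> geodesic g I gam -> unparametrized_geodesic g I gam.
Proof.
move=> Io gI.
have d1 : derive1n 1 (id : R -> R) = cst 1 by apply/funext => s; exact: derive1_id.
have d2 k : derive1n k.+2 (id : R -> R) = cst 0.
  elim: k => [|k IH].
    rewrite -[derive1n 2 id]/(derive1 (derive1n 1 id)) d1.
    by apply/funext => s; rewrite derive1_cst.
  rewrite -[derive1n k.+3 id]/(derive1 (derive1n k.+2 id)) IH.
  by apply/funext => s; rewrite derive1_cst.
exists I, id; split; [exact: Io| |by move=> t _; rewrite derive1_id oner_eq0|
  by rewrite image_id|exact: gI].
case=> [|[|k]] t _; first exact: derivable_id.
- by rewrite d1; exact: derivable_cst.
- by rewrite d2; exact: derivable_cst.
Qed.

(** The [g]-geodesic [x] with initial data (x0, v0) solves the equation of [h] after some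
    reparametrisation [phi]. With z = x o phi, z' = phi' v and z'' = phi'' v - phi'^2 Gamma(v,v),
    this says phi'^2 T(v,v) = - phi'' v. Proportionality is stated by 2x2 minors, which also covers
    zero components of v. *)
Lemma geodesically_equivalent_parallel g h c x0 : geodesically_equivalent g h ->
  ccod (atlas c) x0 -> forall (v0 : 'rV[R]_n) i l,
  let T i j k := christoffel (h c) i j k x0 - christoffel (g c) i j k x0 in
  (\sum_j \sum_k T i j k * v0 0 j * v0 0 k) * v0 0 l =
  (\sum_j \sum_k T l j k * v0 0 j * v0 0 k) * v0 0 i.
Proof.
move=> gh Ux0 v0 i l T.
have [r r0 [x [v [x00 v00 xv gx]]]] := geodesic_exists g v0 Ux0.
set I := [set t : R | `|t| < r] in gx.
have IE : I = [set` `]-r, r[].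
  by apply/seteqP; split => t; rewrite /I /= in_itv/= ltr_norml.
have Io : open_interval I.
  by rewrite IE; split; [exact: itv_open|exact: interval_is_interval].
have [J [phi [[Jo _] dphi phi0 phiJ ghJ]]] :=
  (gh I _ Io).1 (geodesic_unparametrized Io gx).
(* A parameter at which the reparametrised curve passes through [x0]: [phi] maps onto [I], which
   contains 0. *)
have [t0 Jt0 pt0] : (phi @` J) 0 by rewrite phiJ /I/= normr0.
have dphi_at t : J t -> is_derive t (1 : R) phi (derive1 phi t).
  by move=> Jt; rewrite derive1E; apply: derivableP; exact: (dphi 0%N).
have d2phi : is_derive t0 (1 : R) (derive1 phi) (derive1n 2 phi t0).
  by rewrite [derive1n 2 _ _]derive1E; apply: derivableP; exact: (dphi 1%N).
have Iphi t : J t -> `|phi t| < r.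
  by move=> Jt; have : I (phi t) by rewrite -phiJ; exists t.
have nJ : \forall t \near t0, J t by exact: open_nbhs_nbhs.
have [_ /(_ c)] := ghJ t0 Jt0.
have Ut0 : ccod (atlas c) (x (phi t0)) by have [] := xv _ (Iphi _ Jt0).
rewrite /= => /(_ (cinv_dom Ut0)); rewrite (cinvK Ut0) pt0 x00 => H.
pose z i (s : R) := cmap (atlas c) (cinv (atlas c) (x (phi s))) 0 i.
pose a i := - \sum_j \sum_k christoffel (g c) i j k x0 * v0 0 j * v0 0 k.
have sd j : [/\ derivable (z j) t0 1, derivable (derive1 (z j)) t0 1,
    derive1 (z j) t0 = v (phi t0) 0 j * derive1 phi t0
  & derive1n 2 (z j) t0 =
      a j * derive1 phi t0 * derive1 phi t0 + v0 0 j * derive1n 2 phi t0].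
  apply: (@second_derivative _ _ (fun s => v (phi s) 0 j * derive1 phi s)).
    apply: filterS (open_nbhs_nbhs (conj Jo Jt0)) => s Js.
    have [_ dx _] := xv _ (Iphi s Js).
    have := is_derive_outer (dx j) (dphi_at s Js).
    apply: is_derive_near; apply: filterS (open_nbhs_nbhs (conj Jo Js)) => u Ju.
    by have [Uu _ _] := xv _ (Iphi u Ju); rewrite /z cinvK.
  have [_ _ dv] := xv _ (Iphi t0 Jt0).
  have := is_derive_prod (is_derive_outer (dv j) (dphi_at t0 Jt0)) d2phi.
  by rewrite pt0 v00 x00.
(* The geodesic equation of [h] at [t0], with the second derivative of [z] eliminated by the
   equation of [g]. *)
have E j : derive1 phi t0 ^+ 2 * \sum_b \sum_k T j b k * v0 0 b * v0 0 k =
    - derive1n 2 phi t0 * v0 0 j.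
  have [_ _ Hj] := H j.
  have [_ _ _ z2] := sd j.
  have z1 b : derive1 (z b) t0 = v0 0 b * derive1 phi t0.
    by have [_ _ -> _] := sd b; rewrite pt0 v00.
  have -> : \sum_b \sum_k T j b k * v0 0 b * v0 0 k =
     \sum_b \sum_k christoffel (h c) j b k x0 * v0 0 b * v0 0 k + a j.
    rewrite /a -sumrB; apply: eq_bigr => b _; rewrite -sumrB; apply: eq_bigr => k _.
    by rewrite /T !mulrBl.
  have S : \sum_b \sum_k christoffel (h c) j b k x0 * derive1 (z b) t0 * derive1 (z k) t0
     = derive1 phi t0 ^+ 2 * \sum_b \sum_k christoffel (h c) j b k x0 * v0 0 b * v0 0 k.
    rewrite mulr_sumr; apply: eq_bigr => b _; rewrite mulr_sumr; apply: eq_bigr => k _.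
    rewrite !z1; move: (christoffel _ _ _ _ _) (derive1 phi t0) (v0 0 b) (v0 0 k) => *.
    by ring.
  have Hz : derive1n 2 (z j) t0 +
    \sum_b \sum_k christoffel (h c) j b k x0 * derive1 (z b) t0 * derive1 (z k) t0 = 0 := Hj.
  move: Hz; rewrite z2 S.
  move: (\sum_b \sum_k christoffel (h c) j b k x0 * v0 0 b * v0 0 k) (derive1 phi t0).
  move: (derive1n 2 phi t0) (v0 0 j) (a j) => p q b s w Hz.
  apply/eqP; rewrite -subr_eq0 -[X in _ == X]Hz; apply/eqP; ring.
have p0 : derive1 phi t0 ^+ 2 != 0 by rewrite expf_neq0// phi0.
apply: (mulfI p0); rewrite !mulrA !E.
by rewrite -!mulrA [v0 0 i * _]mulrC.
Qed.

End Geodesics.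

Theorem theorem7 (R : realType) (n : nat) (M : manifold R n)
  (g gbar : metric M)
  (hequiv : geodesically_equivalent g gbar)
  (hnonprop : ~ proportional g gbar)
  (c : chart_index M) (p : M) (hp : cdom (atlas c) p) :
  let x := cmap (atlas c) p in
  sectional_operator (g c x) (curvature_op (g c) x)
    (a_op (g c) (gbar c) x) (b_op (g c) (gbar c) x).
Proof.
move=> x; have Ux : ccod (atlas c) x by exact: cmap_cod.
apply: (curvature_sectional (@ccod_open _ _ _ (atlas c))) Ux.
- exact: gcomp_smooth.
- exact: gcomp_sym.
- exact: gcomp_nondegenerate.
- exact: gcomp_smooth.
- exact: gcomp_sym.
- exact: gcomp_nondegenerate.
- by move=> y Uy v i l; exact: geodesically_equivalent_parallel.
Qed.
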